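(* There exists an uncountable family $(\Gamma_i)_{i\in I}$ of finitely generated $3$-step solvable groups such that for all $i\neq j$ in $I$ there is no regular map from $\Gamma_i$ to $\Gamma_j$, and $\Gamma_i$ and $\Gamma_j$ are not $\mathrm L^1$ measure equivalent. Moreover, one can assume that all the groups $\Gamma_i$ have asymptotic dimension one.
   Context: Finitely generated groups are equipped with word metrics associated to finite symmetric generating sets; $|\cdot|_S$ denotes word length. A map $f\colon\Gamma\to\Lambda$ between finitely generated groups is regular if it is Lipschitz and $\sup_{\lambda\in\Lambda}|f^{-1}(\{\lambda\})|<\infty$. A measure equivalence coupling from $\Gamma$ to $\Lambda$ is a quadruple $(\Omega,X_\Gamma,X_\Lambda,\mu)$, where $(\Omega,\mu)$ is a standard Borel space with a nonzero $\sigma$-finite measure, equipped with commuting, free (up to null sets), measure-preserving actions of $\Gamma$ and $\Lambda$, denoted $*$, and $X_\Gamma$, $X_\Lambda$ are Borel fundamental domains of finite measure for the $\Gamma$-action and the $\Lambda$-action respectively (a fundamental domain is a Borel set meeting almost every orbit in exactly one point). The group $\Gamma$ acts on $X_\Lambda$ by $\{\gamma\cdot x\}=(\Lambda*\gamma*x)\cap X_\Lambda$, with cocycle $\alpha\colon\Gamma\times X_\Lambda\to\Lambda$ given by $\alpha(\gamma,x)*\gamma*x=\gamma\cdot x$; symmetrically $\Lambda$ acts on $X_\Gamma$ with cocycle $\beta\colon\Lambda\times X_\Gamma\to\Gamma$. Two finitely generated groups $\Gamma,\Lambda$ are $\mathrm L^1$ measure equivalent if there is such a coupling with $\int_{X_\Lambda}|\alpha(\gamma,x)|_{S_\Lambda}d\mu(x)<\infty$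 for all $\gamma\in\Gamma$ and $\int_{X_\Gamma}|\beta(\lambda,x)|_{S_\Gamma}d\mu(x)<\infty$ for all $\lambda\in\Lambda$. *)

(* Defs.v *)
From HB Require Import structures.
From mathcomp Require Import all_boot all_order all_algebra.
From mathcomp Require Import all_classical all_reals all_analysis.

Set Implicit Arguments.
Unset Strict Implicit.
Unset Printing Implicit Defensive.

Local Open Scope classical_set_scope.
Local Open Scope ring_scope.

Section Groups.
Variable G : groupType.

Definition generated (A : set G) : set G :=
  smallest (fun H : set G => group_closed (mem H)) A.

Fixpoint derived_series (n : nat) : set G :=
  if n is m.+1 then
    generated [set [~ x, y]%g | x in derived_series m & y in derived_series m]
  else [set: G].

Definition step_solvable (n : nat) : Prop :=
  derived_series n = [set 1%g] /\
  forall m, (m < n)%N -> derived_series m <> [set 1%g].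

Definition finitely_generated : Prop :=
  exists2 S : set G, finite_set S & generated S = [set: G].

Definition finite_symmetric_generating (S : set G) : Prop :=
  [/\ finite_set S, forall s, S s -> S (s^-1)%g & generated S = [set: G]].

Definition spelled (S : set G) (n : nat) (g : G) : Prop :=
  exists w : seq G,
    [/\ size w = n, forall s, s \in w -> S s & (\prod_(s <- w) s)%g = g].

(* The default value 0 is only taken when g is not a word in S, hence never
   when S is symmetric and generates G. *)
Definition word_length (S : set G) (g : G) : nat :=
  xget 0%N [set n | spelled S n g /\ forall m, spelled S m g -> (n <= m)%N].

Definition word_dist (S : set G) (x y : G) : nat :=
  word_length S (x^-1 * y)%g.

End Groups.

(* The choice of generating sets is immaterial: changing them only changes
   word metrics up to bi-Lipschitz equivalence. *)
Definition regular (G H : groupType) (f : G -> H) : Prop :=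
  exists (S : set G) (T : set H),
    [/\ finite_symmetric_generating S, finite_symmetric_generating T,
        exists C : nat, forall x y,
          (word_dist T (f x) (f y) <= C * word_dist S x y)%N
      & exists m : nat, forall h : H, (f @^-1` [set h] #<= `I_m)%card].

(* For every scale r, the space is covered by n + 1 families of uniformly
   bounded sets, distinct members of the same family being at distance > r. *)
Definition asdim_le (X : Type) (dist : X -> X -> nat) (n : nat) : Prop :=
  forall r : nat, exists (U : 'I_n.+1 -> set (set X)) (D : nat),
    [/\ forall x, exists k A, U k A /\ A x,
        forall k A, U k A -> forall x y, A x -> A y -> (dist x y <= D)%N
      & forall k A B, U k A -> U k B -> A <> B ->
          forall x y, A x -> B y -> (r < dist x y)%N].

Definition asymptotic_dimension (G : groupType) (n : nat) : Prop :=
  exists S : set G,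
    [/\ finite_symmetric_generating S, asdim_le (word_dist S) n
      & forall m, (m < n)%N -> ~ asdim_le (word_dist S) m].

(* A Hausdorff pseudometric space is metric, so P ranges over Polish spaces. *)
Definition standard_borel (R : realType) (d : measure_display)
    (T : measurableType d) : Prop :=
  exists (P : completePseudoMetricType R) (f : P -> T),
    [/\ hausdorff_space P,
        exists2 D : set P, countable D & dense D,
        bijective f
      & forall A : set T, measurable A <-> <<s @open P >> (f @^-1` A)].

Section Actions.
Context (R : realType) (d : measure_display) (T : measurableType d).
Context (mu : {measure set T -> \bar R}) (G : groupType).
Variable act : G -> T -> T.

Definition is_action : Prop :=
  (forall x, act 1%g x = x) /\
  (forall g h x, act (g * h)%g x = act g (act h x)).

Definition measure_preserving : Prop :=
  forall g, measurable_fun [set: T] (act g) /\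
    forall A, measurable A -> mu (act g @^-1` A) = mu A.

Definition essentially_free : Prop :=
  {ae mu, forall x, forall g, g <> 1%g -> act g x <> x}.

Definition orbit_of (x : T) : set T := [set act g x | g in [set: G]].

Definition fundamental_domain (X : set T) : Prop :=
  measurable X /\
  {ae mu, forall x, exists! y, (orbit_of x `&` X) y}.

End Actions.

Record me_coupling (R : realType) (G L : groupType) := MECoupling {
  me_disp : measure_display;
  me_space : measurableType me_disp;
  me_mu : {sigma_finite_measure set me_space -> \bar R};
  me_actG : G -> me_space -> me_space;
  me_actL : L -> me_space -> me_space;
  me_domG : set me_space;
  me_domL : set me_space;
  me_standard : standard_borel R me_space;
  me_nonzero : me_mu [set: me_space] <> 0%E;
  me_actionG : is_action me_actG;
  me_actionL : is_action me_actL;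
  me_commute : forall g l x,
    me_actG g (me_actL l x) = me_actL l (me_actG g x);
  me_freeG : essentially_free me_mu me_actG;
  me_freeL : essentially_free me_mu me_actL;
  me_preservingG : measure_preserving me_mu me_actG;
  me_preservingL : measure_preserving me_mu me_actL;
  me_fundG : fundamental_domain me_mu me_actG me_domG;
  me_fundL : fundamental_domain me_mu me_actL me_domL;
  me_finG : (me_mu me_domG < +oo)%E;
  me_finL : (me_mu me_domL < +oo)%E
}.

Arguments me_disp {R G L} _.
Arguments me_space {R G L} _.
Arguments me_mu {R G L} _.
Arguments me_actG {R G L} _.
Arguments me_actL {R G L} _.
Arguments me_domG {R G L} _.
Arguments me_domL {R G L} _.

Section Cocycles.
Context (d : measure_display) (T : measurableType d) (G L : groupType).
Variables (actG : G -> T -> T) (actL : L -> T -> T) (X : set T).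

(* When X is a fundamental domain of the action of L, the sets below are
   singletons for almost every x in X; the default values are irrelevant. *)
Definition induced_action (g : G) (x : T) : T :=
  xget x (orbit_of actL (actG g x) `&` X).

Definition cocycle (g : G) (x : T) : L :=
  xget 1%g [set l | actL l (actG g x) = induced_action g x].

End Cocycles.

Definition L1_measure_equivalent (R : realType) (G L : groupType) : Prop :=
  exists (c : me_coupling R G L) (S : set G) (T : set L),
    [/\ finite_symmetric_generating S, finite_symmetric_generating T,
        forall g : G,
          (\int[me_mu c]_(x in me_domL c)
             (word_length T
                (cocycle (me_actG c) (me_actL c) (me_domL c) g x))%:R%:E < +oo)%E
      & forall l : L,
          (\int[me_mu c]_(x in me_domG c)
             (word_length S
                (cocycle (me_actL c) (me_actG c) (me_domG c) l x))%:R%:E < +oo)%E].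

(* Main.v *)
(* Idea. Folner functions are monotone under regular maps and under L1 measure
   equivalence: if the Folner sets of H are pulled back along a map f from G
   (averaging over translates, inside a large Folner set of G), or along the
   orbits of a coupling, one gets sets in G with a comparable boundary ratio
   and size. It therefore suffices to find uncountably many groups with
   pairwise incomparable Folner functions. They are diagonal products of
   lamplighter groups over Z with finite dihedral lamp groups D_k, as in
   Brieussel-Zheng: the generators a and b write the two reflections of D_k at
   the sites 0 and m_k, and a set A of integers selects the coordinates k that
   are present. Below the scale m_k the coordinate k looks like a lamplighter
   over (Z/2)^2, whose Folner function is at most C^n, while at a scale n
   comparable to q m_k, where q is the order of D_k, it forces Folner sets of
   size at least q^(cn), by Han's entropy inequality. Choosing q large in terms
   of the previous coordinates, and then m_(k+1) larger than k n, the Folner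
   function at this scale decides whether k is in A. An almost disjoint family
   of sets A gives the result. *)

Require Import Defs.
From Stdlib Require Import Relation_Operators.
From HB Require Import structures.
From mathcomp Require Import all_boot all_order all_algebra.
From mathcomp Require Import zify ring lra.
From mathcomp Require Import all_classical all_reals all_analysis.
From mathcomp Require Import measurable_realfun.

Import Order.TTheory GRing.Theory Num.Theory.

Local Open Scope classical_set_scope.

Set Implicit Arguments.
Unset Strict Implicit.
Unset Printing Implicit Defensive.

(** * Counting, words and Folner sets *)

(** The obstacle is the constant of a domination, which is arbitrary and acts both on the scale and
    on the size. It is absorbed because two distinct sequences are separated by infinitely many
    coordinates k, so k may exceed the constant; this is why a window of width k n, and not only n,
    must still see (Z/2)^2 lamps in the later coordinates. Sets are pulled back rather than pushed
    forward. A regular map need not be onto, so the preimage of one Folner set may be empty, whence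
    the average over translates. The same principle recurs throughout: an inequality known on
    average holds for some translate, some point of a fundamental domain, some slice or some level
    of a fibre count, and one choice must serve all generators at once. *)

Section Counting.

Lemma count_sum (T : Type) (a : pred T) (s : seq T) :
  count a s = (\sum_(x <- s) a x)%N.
Proof. by rewrite -sum1_count big_mkcond; apply: eq_bigr => x _; case: (a x). Qed.

Lemma leq_count_inj (T T' : eqType) (f : T -> T') (a : pred T) (b : pred T')
    (s : seq T) (s' : seq T') :
  uniq s -> {in s &, injective f} ->
  (forall x, x \in s -> a x -> (f x \in s') && b (f x)) ->
  (count a s <= count b s')%N.
Proof.
move=> us finj sub; rewrite -!size_filter -(size_map f).
apply: uniq_leq_size => [|y /mapP[x]].
  rewrite map_inj_in_uniq ?filter_uniq// => x y.
  by rewrite !mem_filter => /andP[_ xs] /andP[_ ys]; apply: finj.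
by rewrite mem_filter => /andP[ax xs] ->; rewrite mem_filter andbC sub.
Qed.

Lemma count_leq1 (T : eqType) (a : pred T) (s : seq T) : uniq s ->
  (forall x y, x \in s -> y \in s -> a x -> a y -> x = y) ->
  (count a s <= 1)%N.
Proof.
move=> us a_inj; rewrite -size_filter.
have ss x y : x \in [seq z <- s | a z] -> y \in [seq z <- s | a z] -> x = y.
  by rewrite !mem_filter => /andP[ax xs] /andP[ay ys]; apply: a_inj.
case: [seq z <- s | a z] (filter_uniq a us) ss => [|x [|y t]]//= /andP[+ _] ss.
by rewrite (ss x y) ?inE eqxx ?orbT.
Qed.

Lemma leq_sum_seq (T : eqType) (s : seq T) (u v : T -> nat) :
  (forall x, x \in s -> (u x <= v x)%N) ->
  (\sum_(x <- s) u x <= \sum_(x <- s) v x)%N.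
Proof. by move=> uv; rewrite !big_seq; apply: leq_sum. Qed.

Lemma sum_seq_const (T : Type) (s : seq T) c : (\sum_(x <- s) c = size s * c)%N.
Proof. by rewrite big_const_seq count_predT iter_addn_0 mulnC. Qed.

(** Otherwise u exceeds v by at least 1 wherever v is positive, and the sums compare strictly the
    other way. In the applications v is the size of a candidate set, possibly weighted, so the
    second conclusion makes that set nonempty. *)
Lemma exists_leq_of_sum (I : eqType) (r : seq I) (u v : I -> nat) :
  (\sum_(i <- r) u i <= \sum_(i <- r) v i)%N -> (0 < \sum_(i <- r) v i)%N ->
  exists i, (u i <= v i)%N /\ (0 < v i)%N.
Proof.
move=> le_uv v0; apply: contrapT => noi.
have lt_vu i : (v i + (0 < v i) <= u i)%N.
  have [->|v_gt0] := posnP (v i); first by [].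
  by rewrite addn1 ltnNge; apply/negP => uv; apply: noi; exists i.
have : (\sum_(i <- r) (v i + (0 < v i)) <= \sum_(i <- r) v i)%N.
  by apply: leq_trans le_uv; apply: leq_sum => i _.
rewrite big_split/= -[leqRHS]addn0 leq_add2l leqn0 sum_nat_seq_eq0 => /allP vr.
have := v0; rewrite lt0n sum_nat_seq_eq0 => /negP; apply.
by apply/allP => i /vr/=; case: (v i).
Qed.

Definition exits (T : eqType) (F : seq T) (phi : T -> T) : nat :=
  count (fun x => phi x \notin F) F.

Lemma eq_exits (T : eqType) (F : seq T) (phi psi : T -> T) :
  phi =1 psi -> exits F phi = exits F psi.
Proof. by move=> eq_phi; apply: eq_count => x; rewrite eq_phi. Qed.

(** A point leaving F along the composite either leaves under psi, or stays and then leaves under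
    phi; psi injects the points of the second kind into the exits of phi. *)
Lemma exits_comp (T : eqType) (F : seq T) (phi psi : T -> T) :
  uniq F -> injective psi ->
  (exits F (phi \o psi) <= exits F psi + exits F phi)%N.
Proof.
move=> uF psi_inj.
have le_phi : (count (fun x => (psi x \in F) && (phi (psi x) \notin F)) F
    <= exits F phi)%N.
  by apply: (leq_count_inj (f := psi)) => // x y _ _ /psi_inj.
apply: leq_trans (leq_add (leqnn _) le_phi); rewrite -count_predUI.
apply: leq_trans (leq_addr _ _); apply: sub_count => x /= ->.
by rewrite andbT orNb.
Qed.

Lemma size_leq_card (T : choiceType) (s : seq T) (A : set T) m :
  uniq s -> (forall x, x \in s -> A x) -> (A #<= `I_m)%card -> (size s <= m)%N.
Proof.
move=> us sA /pcard_leP/unsquash f.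
rewrite -(size_map f) -[leqRHS](size_iota 0); apply: uniq_leq_size.
  rewrite map_inj_in_uniq// => x y xs ys; apply: 'inj_f.
    exact/mem_set/sA.
  exact/mem_set/sA.
by move=> _ /mapP[x /sA Ax ->]; rewrite mem_iota; exact: 'funS_f.
Qed.

End Counting.

Section Words.
Variable G : groupType.
Implicit Types (S : set G) (x y g : G).

Lemma generated_group_closed (A : set G) : group_closed (mem (generated A)).
Proof.
split=> [|x y /set_mem Ax /set_mem Ay]; apply/mem_set => H [HG AH].
  by have [/set_mem] := HG.
by have [_ HB] := HG; apply/set_mem/HB; apply/mem_set; [apply: Ax|apply: Ay].
Qed.

Lemma sub_generated (A : set G) : A `<=` generated A.
Proof. by move=> x Ax H [_ AH]; apply: AH. Qed.

Lemma generated_min (A H : set G) :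
  group_closed (mem H) -> A `<=` H -> generated A `<=` H.
Proof. by move=> HG AH x; apply. Qed.

(** Since S is symmetric, the elements it spells form a subgroup; so the minimum exists and [xget]
    does not fall back on 0. *)
Lemma spelled_length S g :
  (forall s, S s -> S (s^-1)%g) -> generated S = [set: G] ->
  spelled S (word_length S g) g.
Proof.
move=> SV Sgen.
have [n Sn] : exists n, spelled S n g.
  have : generated S g by rewrite Sgen.
  apply: (generated_min (H := [set g | exists n, spelled S n g])) => [|s Ss].
    split=> [|x y /set_mem[n [w [_ wS <-]]] /set_mem[m [w' [_ wS' <-]]]].
      by apply/mem_set; exists 0%N, [::]; split=> //; rewrite big_nil.
    apply/mem_set; exists (size (w ++ rev (map (fun s : G => s^-1)%g w'))).
    exists (w ++ rev (map (fun s : G => s^-1)%g w')); split=> //.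
      move=> s; rewrite mem_cat mem_rev => /orP[/wS//|/mapP[s' /wS' Ss' ->]].
      exact: SV.
    by rewrite big_cat /= -map_rev big_map prodgV revK.
  by exists 1%N, [:: s]; split=> // [s'|]; rewrite ?big_seq1 // inE => /eqP->.
rewrite /word_length; case: xgetP => [m -> []//|].
have exS : exists n, `[< spelled S n g >] by exists n; apply/asboolP.
case: (ex_minnP exS) => m /asboolP Sm mmin /(_ m) []; split=> // k /asboolP.
exact: mmin.
Qed.

Lemma word_length_min S g m : spelled S m g -> (word_length S g <= m)%N.
Proof.
move=> Sm; rewrite /word_length; case: xgetP => [k -> [_]|//]; exact.
Qed.

Lemma spelledV S n g : (forall s, S s -> S (s^-1)%g) ->
  spelled S n g -> spelled S n (g^-1)%g.
Proof.
move=> SV [w [<- wS <-]]; exists (rev (map (fun s : G => s^-1)%g w)); split.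
- by rewrite size_rev size_map.
- by move=> s; rewrite mem_rev => /mapP[s' /wS/SV Ss' ->].
- by rewrite -map_rev big_map prodgV revK.
Qed.

Lemma word_lengthV S g : (forall s, S s -> S (s^-1)%g) ->
  generated S = [set: G] -> word_length S (g^-1)%g = word_length S g.
Proof.
move=> SV Sgen; apply/eqP; rewrite eqn_leq.
rewrite word_length_min; last exact/spelledV/spelled_length.
by rewrite word_length_min// -{2}[g]invgK; apply/spelledV/spelled_length.
Qed.

End Words.

Section Boundary.
Variable G : groupType.
Implicit Types (S : set G) (F : seq G) (s t g : G).

Definition bd F s : nat := exits F (fun x => x * s)%g.

(** The Folner function at n is at most v. A relation avoids a minimum that exists only for amenable
    groups; for n = 0 the boundary condition is void. *)
Definition folner S (n v : nat) : Prop :=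
  exists F : seq G, [/\ uniq F, (0 < size F <= v)%N
    & forall s, S s -> (n * bd F s <= size F)%N].

Lemma bd1 F : bd F 1%g = 0%N.
Proof. by apply/eqP; rewrite -leqn0 leqNgt -has_count; apply/hasPn => x; rewrite mulg1 negbK. Qed.

Lemma bdM F s t : uniq F -> (bd F (s * t)%g <= bd F s + bd F t)%N.
Proof.
move=> uF; rewrite /bd -(@eq_exits _ _ ((fun x => x * t) \o (fun x => x * s))%g).
  by apply: exits_comp => //; apply: mulIg.
by move=> x /=; rewrite mulgA.
Qed.

Lemma bd_spelled F S k g b : uniq F -> (forall s, S s -> (bd F s <= b)%N) ->
  spelled S k g -> (bd F g <= k * b)%N.
Proof.
move=> uF Fb [w [<- wS <-]]; elim: w wS => [|s w IH] wS.
  by rewrite big_nil bd1.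
rewrite big_cons mulSn; apply: leq_trans (bdM _ _ uF) _; apply: leq_add.
  by apply/Fb/wS; rewrite mem_head.
by apply: IH => s' ws'; apply: wS; rewrite inE ws' orbT.
Qed.

Lemma folner_change S T : finite_set S -> finite_symmetric_generating T ->
  exists2 c, (0 < c)%N & forall n v, folner T (c * n) v -> folner S n v.
Proof.
move=> Sfin [Tfin TV Tgen]; move/finite_seqP: Sfin => [s ->].
(* The successor keeps the constant positive when all the lengths vanish. *)
exists (\max_(g <- s) word_length T g).+1 => // n v [F [uF Fv Fb]].
exists F; split=> // g /= gs.
have [-> //|n0] := posnP n.
set c := (\max_(g <- s) word_length T g).+1 in Fb.
have cn0 : (0 < c * n)%N by rewrite muln_gt0 n0.
have Fb' t : T t -> (bd F t <= size F %/ (c * n))%N.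
  by move=> /Fb; rewrite leq_divRL// mulnC.
have := bd_spelled uF Fb' (spelled_length g TV Tgen).
rewrite -(leq_pmul2l n0) => /leq_trans; apply.
apply: leq_trans (leq_divM (size F) (c * n)).
rewrite mulnCA mulnA [leqRHS]mulnC leq_mul2r leq_mul2r; apply/orP; right.
apply/orP; right; apply: leqW.
by rewrite (@leq_bigmax_seq _ s xpredT (word_length T)).
Qed.

End Boundary.

(** In terms of Folner functions, Fol_G(n) <= C Fol_H(C n). *)
Definition folner_dominated (G H : groupType) (S : set G) (T : set H) : Prop :=
  exists2 C, (0 < C)%N
    & forall n v, folner T (C * n) v -> folner S n (C * v).

Lemma folner0 (G : groupType) (S : set G) v : (0 < v)%N -> folner S 0 v.
Proof. by move=> v0; exists [:: 1%g]. Qed.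

(** Let A l be the part of a large Folner set K of G that f sends into l F. Each point of K lies in
    exactly |F| of these sets, so sizes and boundaries are known on average over l. A point x leaves
    A l along t either by leaving K, or because F is left along (f x)^-1 f (x t), whose length is at
    most C. *)
Lemma regular_folner_dominated (G H : groupType) (f : G -> H) :
  regular f -> (forall S : set G, finite_symmetric_generating S ->
    forall n, exists v, folner S n v) ->
  exists (S : set G) (T : set H), [/\ finite_symmetric_generating S,
    finite_symmetric_generating T & folner_dominated S T].
Proof.
move=> [S [T [SG TG [C fC] [m fm]]]] amen; exists S, T; split=> //.
move: (SG) (TG) => [/finite_seqP[s Ss] SV Sgen] [Tfin TV Tgen].
(* The 2 shares the allowed boundary between K and F; size s + 1 pays for the sum over all
   generators. *)
pose B := (2 * ((size s).+1 * C.+1))%N.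
exists (B * m.+1)%N => [|n v]; first by rewrite !muln_gt0.
have [->|n0] := posnP n.
  rewrite muln0 => -[F [_ /andP[F0 Fv] _]]; apply: folner0.
  by rewrite !muln_gt0 (leq_trans F0 Fv).
move=> [F [uF /andP[F0 Fv] FB]].
have [w [K [uK /andP[K0 _] KB]]] := amen S SG (2 * ((size s).+1 * n))%N.
(* The translates l F that meet the image of K; any other l gives an empty [A l]. *)
pose L := undup [seq (f x * y^-1)%g | x <- K, y <- F].
have uL : uniq L by apply: undup_uniq.
pose A l := [seq x <- K | (l^-1 * f x)%g \in F].
have bij_ge x : x \in K ->
    (size F <= count (fun l => (l^-1 * f x)%g \in F) L)%N.
  move=> xK; rewrite -[size F]count_predT.
  apply: (leq_count_inj (f := fun y => f x * y^-1)%g) => //.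
    by move=> y z _ _ /mulgI/invg_inj.
  move=> y yF _; rewrite invgM invgK mulgVK yF andbT mem_undup.
  by apply/allpairsP; exists (x, y).
have bij_le x : (count (fun l => (l^-1 * f x)%g \in F) L <= size F)%N.
  rewrite -[size F]count_predT.
  apply: (leq_count_inj (f := fun l => l^-1 * f x)%g) => //.
    by move=> y z _ _ /mulIg/invg_inj.
  by move=> l _ /= ->.
have bij_bd x h : (count (fun l => ((l^-1 * f x)%g \in F) &&
    ((l^-1 * f x * h)%g \notin F)) L <= bd F h)%N.
  apply: (leq_count_inj (f := fun l => l^-1 * f x)%g) => //.
  by move=> y z _ _ /mulIg/invg_inj.
have sumA : (size K * size F <= \sum_(l <- L) size (A l))%N.
  under eq_bigr do rewrite size_filter count_sum.
  rewrite exchange_big/= -sum_seq_const; apply: leq_sum_seq => x xK.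
  by rewrite -count_sum bij_ge.
have n0' : (0 < B * m.+1 * n)%N by rewrite !muln_gt0.
pose b := (size F %/ (B * n))%N.
have FT t : T t -> (bd F t <= b)%N.
  move=> /FB Ft; rewrite leq_divRL ?muln_gt0//; apply: leq_trans Ft.
  by rewrite [leqLHS]mulnC; apply: leq_mul => //; nia.
have bdf x t : t \in s -> (bd F ((f x)^-1 * f (x * t))%g <= C * b)%N.
  move=> ts; apply: leq_trans (bd_spelled uF FT (spelled_length _ TV Tgen)) _.
  rewrite leq_mul2r; apply/orP; right; apply: leq_trans (fC _ _) _.
  rewrite -[leqRHS]muln1 leq_mul2l; apply/orP; right.
  apply: word_length_min; exists [:: t]; split=> //.
    by move=> t'; rewrite inE => /eqP->; rewrite Ss.
  by rewrite big_seq1 mulKg.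
have bdA t : t \in s -> (\sum_(l <- L) bd (A l) t <=
    bd K t * size F + size K * (C * b))%N.
  move=> ts.
  apply: (@leq_trans (\sum_(l <- L) \sum_(x <- K)
    (((x * t)%g \notin K) && ((l^-1 * f x)%g \in F) +
     ((l^-1 * f x)%g \in F) && ((l^-1 * f (x * t))%g \notin F)))).
    apply: leq_sum => l _; rewrite /bd /exits count_filter count_sum.
    apply: leq_sum => x _ /=; rewrite mem_filter.
    by do 3!case: (_ \in _).
  rewrite exchange_big/=; under eq_bigr do rewrite big_split/=.
  rewrite big_split/=; apply: leq_add.
    rewrite /bd /exits count_sum big_distrl/=; apply: leq_sum => x _.
    case: (_ \notin _) => /=; last by rewrite big1.
    by rewrite -count_sum mul1n bij_le.
  rewrite -sum_seq_const; apply: leq_sum => x _; rewrite -count_sum.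
  apply: leq_trans (bdf x t ts); apply: leq_trans (bij_bd x _).
  by apply: sub_count => l /=; rewrite mulgA mulgK.
have [l [lA A0]] : exists l,
    (n * (\sum_(t <- s) bd (A l) t) <= size (A l))%N /\ (0 < size (A l))%N.
  apply: (@exists_leq_of_sum _ L); last first.
    by apply: leq_trans sumA; rewrite muln_gt0 K0.
  apply: leq_trans sumA; rewrite -big_distrr exchange_big/=.
  apply: (@leq_trans (n * \sum_(t <- s)
     (size K %/ (2 * ((size s).+1 * n)) * size F + size K * (C * b)))).
    rewrite leq_mul2l; apply/orP; right; apply: leq_sum_seq => t ts.
    apply: leq_trans (bdA t ts) _; rewrite leq_add2r leq_mul2r.
    by rewrite leq_divRL ?muln_gt0// mulnC KB ?orbT// Ss.
  rewrite sum_seq_const.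
  set k := (size K %/ _)%N.
  have k_le : (2 * (n * (size s * k)) <= size K)%N.
    apply: leq_trans (leq_divM (size K) (2 * ((size s).+1 * n))).
    rewrite -/k; nia.
  have b_le : (2 * (n * (size s * (C * b))) <= size F)%N.
    apply: leq_trans (leq_divM (size F) (B * n)); rewrite -/b /B; nia.
  nia.
exists (A l); split; rewrite ?filter_uniq ?A0//=.
  apply: (@leq_trans (m * size F)); last first.
    by rewrite leq_mul//; rewrite /B; nia.
  (* Each point of l F has at most m preimages. *)
  rewrite mulnC -sum_seq_const size_filter.
  apply: (@leq_trans (\sum_(y <- F) count (fun x => f x == (l * y)%g) K)).
    under [leqRHS]eq_bigr do rewrite count_sum.
    rewrite exchange_big/= count_sum; apply: leq_sum => x _.
    case: (boolP (_ \in F)) => // yF; rewrite (big_rem _ yF)/=.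
    by rewrite mulVKg eqxx.
  apply: leq_sum => y _; rewrite -size_filter.
  apply: (size_leq_card (A := f @^-1` [set (l * y)%g])) (fm _).
    by rewrite filter_uniq.
  by move=> x; rewrite mem_filter => /andP[/eqP].
move=> t; rewrite Ss => /= ts; apply: leq_trans lA; rewrite leq_mul2l.
by rewrite (big_rem _ ts) leq_addr orbT.
Qed.

(** * Couplings *)

Section MeasurePrelim.
Local Open Scope ring_scope.
Local Open Scope ereal_scope.
Context (R : realType) (d : measure_display) (T : measurableType d).
Variable mu : {measure set T -> \bar R}.

(* Both sides are suprema over the simple functions below the integrand. *)
Lemma ge0_le_integral_sub (D1 D2 : set T) (f1 f2 : T -> \bar R) :
  (forall x, D1 x -> 0 <= f1 x) -> (forall x, D2 x -> 0 <= f2 x) ->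
  (forall x, D1 x -> D2 x /\ f1 x <= f2 x) ->
  \int[mu]_(x in D1) f1 x <= \int[mu]_(x in D2) f2 x.
Proof.
move=> f10 f20 f12; rewrite !ge0_integralE//.
apply: ereal_sup_le => _ [h /= hf <-]; exists h => // x.
apply: le_trans (hf x) _; rewrite /patch.
case: ifPn => [/set_mem D1x|_].
  by have [D2x f12x] := f12 x D1x; rewrite mem_set.
by case: ifPn => // /set_mem; apply: f20.
Qed.

Lemma sume_seq_const (I : Type) (s : seq I) (c : \bar R) :
  \sum_(i <- s) c = (size s)%:R%:E * c.
Proof.
elim: s => [|i s IH]; first by rewrite big_nil mul0e.
by rewrite big_cons IH /= -natr1 EFinD ge0_muleDl ?lee_fin// mul1e addeC.
Qed.

Lemma measurable_exists_seq (I : eqType) (s : seq I) (A : I -> set T) :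
  (forall i, measurable (A i)) -> measurable [set x | exists2 i, i \in s & A i x].
Proof.
move=> mA; elim: s => [|i s IH].
  by rewrite (_ : mkset _ = set0)//; apply/seteqP; split=> // x [].
rewrite (_ : mkset _ = A i `|` [set x | exists2 j, j \in s & A j x]).
  exact: measurableU.
apply/seteqP; split=> x /=.
  move=> [j]; rewrite inE => /orP[/eqP ->|js Aj]; first by left.
  by right; exists j.
by case=> [Ai|[j js Aj]]; [exists i|exists j]; rewrite ?inE ?eqxx ?js ?orbT.
Qed.

Lemma measure_exists_seq (I : eqType) (s : seq I) (A : I -> set T) :
  (forall i, measurable (A i)) -> uniq s ->
  (forall i j x, i \in s -> j \in s -> A i x -> A j x -> i = j) ->
  mu [set x | exists2 i, i \in s & A i x] = \sum_(i <- s) mu (A i).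
Proof.
move=> mA; elim: s => [|i s IH] /=.
  by move=> _ _; rewrite big_nil (_ : mkset _ = set0)//; apply/seteqP; split=> // x [].
move=> /andP[is_ us] dA; rewrite big_cons -IH//; last first.
  by move=> j k x js ks; apply: dA; rewrite inE ?js ?ks orbT.
rewrite (_ : mkset _ = A i `|` [set x | exists2 j, j \in s & A j x]).
  apply: measureU => //; first exact: measurable_exists_seq.
  apply/seteqP; split=> // x [/= Ai [j js Aj]].
  move: is_; rewrite (dA i j x) ?js ?inE ?eqxx ?js ?orbT//.
apply/seteqP; split=> x /=.
  move=> [j]; rewrite inE => /orP[/eqP ->|js Aj]; first by left.
  by right; exists j.
by case=> [Ai|[j js Aj]]; [exists i|exists j]; rewrite ?inE ?eqxx ?js ?orbT.
Qed.

Lemma measure_exists_seq_le (I : eqType) (s : seq I) (A : I -> set T) :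
  (forall i, measurable (A i)) ->
  mu [set x | exists2 i, i \in s & A i x] <= \sum_(i <- s) mu (A i).
Proof.
move=> mA; elim: s => [|i s IH] /=.
  by rewrite big_nil (_ : mkset _ = set0) ?measure0//; apply/seteqP; split=> // x [].
rewrite big_cons; apply: le_trans (leeD (lexx _) IH).
rewrite (_ : mkset _ = A i `|` [set x | exists2 j, j \in s & A j x]).
  by apply: measureU2 => //; apply: measurable_exists_seq.
apply/seteqP; split=> x /=.
  move=> [j]; rewrite inE => /orP[/eqP ->|js Aj]; first by left.
  by right; exists j.
by case=> [Ai|[j js Aj]]; [exists i|exists j]; rewrite ?inE ?eqxx ?js ?orbT.
Qed.

End MeasurePrelim.

(** * Couplings whose axioms hold everywhere on an invariant set *)

Section StrictCoupling.
Local Open Scope ring_scope.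
Local Open Scope ereal_scope.
Context (R : realType) (d : measure_display) (T : measurableType d).
Variable mu : {measure set T -> \bar R}.
Variables (G L : groupType) (aG : G -> T -> T) (aL : L -> T -> T).
Hypothesis actG : is_action aG.
Hypothesis actL : is_action aL.
Hypothesis comm : forall g l x, aG g (aL l x) = aL l (aG g x).
Hypothesis mpG : measure_preserving mu aG.
Hypothesis mpL : measure_preserving mu aL.
Variables (Omega XG XL : set T).
Hypothesis mXG : measurable XG.
Hypothesis mXL : measurable XL.
Hypothesis XL_Omega : XL `<=` Omega.
Hypothesis OmegaL : forall l x, Omega x -> Omega (aL l x).
Hypothesis coverG : forall x, Omega x -> exists g, XG (aG g x).
Hypothesis uniqG : forall x g g', XG (aG g x) -> XG (aG g' x) -> g = g'.
Hypothesis uniqL : forall x l l', XL (aL l x) -> XL (aL l' x) -> l = l'.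
Hypothesis XL_gt0 : 0 < mu XL.
Hypothesis XL_fin : mu XL < +oo.
Variable e : nat -> G.
Hypothesis e_surj : forall g, exists n, e n = g.
Variable kappa : G -> T -> L.
Hypothesis kappaP : forall s y, XL y -> XL (aL (kappa s y) (aG s y)).

Lemma measurable_actG g B : measurable B -> measurable (aG g @^-1` B).
Proof. by move=> mB; have [mg _] := mpG g; rewrite -[X in measurable X]setTI; apply: mg. Qed.

Lemma measurable_actL l B : measurable B -> measurable (aL l @^-1` B).
Proof. by move=> mB; have [ml _] := mpL l; rewrite -[X in measurable X]setTI; apply: ml. Qed.

Lemma mu_actG g B : measurable B -> mu (aG g @^-1` B) = mu B.
Proof. by move=> mB; have [_ ->] := mpG g. Qed.

Lemma mu_actL l B : measurable B -> mu (aL l @^-1` B) = mu B.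
Proof. by move=> mB; have [_ ->] := mpL l. Qed.

Definition covered (s : seq G) : set T :=
  [set y | exists2 g, g \in s & (aG g @^-1` XG) y].

Lemma measurable_covered s : measurable (covered s).
Proof. by apply: measurable_exists_seq => g; apply: measurable_actG. Qed.

(** The parts of B missed by longer and longer prefixes of the enumeration decrease to the empty
    set; continuity from above applies as B has finite measure. *)
Lemma exhaust B (eps : R) : measurable B -> B `<=` Omega -> mu B < +oo ->
  (0 < eps)%R -> exists s : seq G, uniq s /\ mu (B `\` covered s) <= eps%:E.
Proof.
move=> mB BO Bfin eps0.
pose s k := undup [seq e i | i <- iota 0 k].
pose D k := B `\` covered (s k).
have mD k : measurable (D k) by apply: measurableD => //; apply: measurable_covered.
have D0 : \bigcap_k D k = set0.
  apply/seteqP; split=> // y Dy.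
  have [By _] := Dy 0%N I.
  have [g gy] := coverG (BO _ By); have [n en] := e_surj g.
  have [_] := Dy n.+1 I; apply; exists g => //.
  by rewrite mem_undup -en map_f// mem_iota /= add0n.
have cvgD : mu (D k) @[k --> \oo] --> mu (\bigcap_k D k).
  apply: nonincreasing_cvg_mu => //.
  - by apply: le_lt_trans Bfin; apply: le_measure; rewrite ?inE// => x [].
  - by rewrite D0.
  - move=> i j ij; apply/subsetPset => x [Bx nx]; split=> // -[g gi gx].
    apply: nx; exists g => //; move: gi; rewrite !mem_undup.
    move=> /mapP[i' i'i ->]; apply: map_f; move: i'i; rewrite !mem_iota !add0n.
    by move=> /andP[_ i'i]; exact: leq_trans i'i ij.
rewrite D0 measure0 in cvgD.
have eps0' : 0 < eps%:E by rewrite lte_fin.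
have [k _ /(_ k (leqnn k)) Dk] := cvgD _ (open_ereal_lt' eps0').
exists (s k); split; first exact: undup_uniq.
exact: ltW.
Qed.

Section Counting.
Variable s : seq G.
Hypothesis us : uniq s.

Definition hits (B : set T) (x : T) : nat :=
  count (fun g => `[< B (aG g^-1%g x) >]) s.

Lemma hitsE B x :
  (hits B x)%:R%:E = \sum_(g <- s) (\1_(aG g^-1%g @^-1` B) x)%:E :> \bar R.
Proof.
rewrite /hits count_sum natr_sum -sumEFin; apply: eq_bigr => g _.
by rewrite indicE.
Qed.

Lemma measurable_hits B (D : set T) : measurable B ->
  measurable_fun D ((fun x => (hits B x)%:R%:E) : T -> \bar R).
Proof.
move=> mB; under eq_fun do rewrite hitsE.
apply: emeasurable_sum => g; apply/measurable_EFinP.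
by apply: measurable_indic; apply: measurable_actG.
Qed.

(** Unfolding over the fundamental domain: B is the disjoint union over g in s of the pieces that g
    carries into XG, and each g preserves the measure. *)
Lemma integral_hits B : measurable B -> B `<=` covered s ->
  \int[mu]_(x in XG) (hits B x)%:R%:E = mu B.
Proof.
move=> mB Bs.
under eq_integral do rewrite hitsE.
rewrite ge0_integral_sum//; last first.
  move=> g; apply/measurable_EFinP/measurable_indic; exact: measurable_actG.
have BE : B = [set y | exists2 g, g \in s & (aG g @^-1` XG `&` B) y].
  apply/seteqP; split=> y /=; first by move=> By; have [g gs gy] := Bs y By; exists g.
  by move=> [g _ []].
rewrite [in RHS]BE measure_exists_seq//; last 2 first.
- by move=> g; apply: measurableI => //; apply: measurable_actG.
- by move=> g g' y _ _ [gy _] [g'y _]; apply: uniqG gy g'y.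
apply: eq_bigr => g _.
have mgB : measurable (aG g^-1%g @^-1` B) by apply: measurable_actG.
rewrite integral_indic// -(mu_actG g); last exact: measurableI.
congr (mu _); apply/seteqP; have [act1 actM] := actG.
have VK y : aG g^-1%g (aG g y) = y by rewrite -actM mulVg act1.
by split=> y /=; rewrite VK => -[].
Qed.

(** If the reverse inequality held between the counts at every x of XG, integrating it would
    contradict the inequality between the measures. *)
Lemma exists_hits_lt (S : seq G) n (W Wbad : set T) (dW : G -> set T) :
  measurable W -> measurable Wbad -> (forall g, measurable (dW g)) ->
  W `<=` covered s -> Wbad `<=` covered s -> (forall g, dW g `<=` covered s) ->
  \sum_(i < n) \sum_(g <- S) mu (dW g) + (mu Wbad + mu Wbad) < mu W ->
  exists x, XG x /\
    (n * \sum_(g <- S) hits (dW g) x + 2 * hits Wbad x < hits W x)%N.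
Proof.
move=> mW mWbad mdW Ws Wbads dWs lt_mu; apply: contrapT => none.
move: lt_mu; apply/negP; rewrite -leNgt.
pose B (o : option G) := if o is Some g then dW g else Wbad.
have mB o : measurable (B o) by case: o.
have Bs o : B o `<=` covered s by case: o.
(* The multiples n and 2 become repetitions in one list, so that a single finite sum is
   integrated. *)
pose J := flatten (nseq n [seq Some g | g <- S]) ++ [:: None; None].
have sumJ (u : option G -> \bar R) :
    \sum_(o <- J) u o =
      \sum_(i < n) (\sum_(g <- S) u (Some g)) + (u None + u None).
  rewrite big_cat /= !big_cons big_nil adde0; congr (_ + _).
  elim: n {J none} => [|n IH] /=; first by rewrite big_nil big_ord0.
  by rewrite big_cat big_map IH big_ord_recl.
have sumJn (u : option G -> nat) :
    (\sum_(o <- J) u o = n * (\sum_(g <- S) u (Some g)) + 2 * u None)%N.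
  rewrite big_cat /= !big_cons big_nil addn0 mul2n addnn; congr (_ + _)%N.
  by elim: n {J none sumJ} => [|n IH] /=; rewrite ?big_nil// big_cat big_map IH mulSn.
rewrite -(integral_hits mW Ws) -(integral_hits mWbad Wbads).
under eq_bigr do under eq_bigr do rewrite -(integral_hits (mdW _) (dWs _)).
rewrite -(sumJ (fun o => \int[mu]_(x in XG) (hits (B o) x)%:R%:E)).
rewrite -ge0_integral_sum//; last by move=> o; apply: measurable_hits.
apply: ge0_le_integral => //.
- exact: measurable_hits.
- by apply: emeasurable_sum => o; apply: measurable_hits.
- move=> x XGx; rewrite sumEFin -natr_sum lee_fin ler_nat sumJn leqNgt.
  by apply/negP => lt_hits; apply: none; exists x.
Qed.

End Counting.

Section Thickening.
Variables (T' : set L) (I_ : G -> R).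
Hypothesis T'P : finite_symmetric_generating T'.
Hypothesis I_P : forall g,
  \int[mu]_(x in XL) (word_length T' (kappa g x))%:R%:E <= (I_ g)%:E.
Variables (F : seq L) (b : nat).
Hypothesis uF : uniq F.
Hypothesis Fb : forall t, T' t -> (bd F t <= b)%N.

Definition thick (B : set T) : set T :=
  [set y | exists2 l, l \in F & (aL l^-1%g @^-1` B) y].

Lemma measurable_thick B : measurable B -> measurable (thick B).
Proof. by move=> mB; apply: measurable_exists_seq => l; apply: measurable_actL. Qed.

Lemma mu_thick_le B : measurable B -> mu (thick B) <= (size F)%:R%:E * mu B.
Proof.
move=> mB; apply: le_trans (measure_exists_seq_le _ _ _) _ => [l|].
  exact: measurable_actL.
under eq_bigr do rewrite mu_actL//.
by rewrite sume_seq_const.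
Qed.

Lemma mu_thick : mu (thick XL) = (size F)%:R%:E * mu XL.
Proof.
rewrite measure_exists_seq//.
- under eq_bigr do rewrite mu_actL//.
  by rewrite sume_seq_const.
- by move=> l; apply: measurable_actL.
- by move=> l l' y _ _ ly l'y; apply: invg_inj; apply: uniqL ly l'y.
Qed.

Lemma thick_Omega : thick XL `<=` Omega.
Proof.
have [act1 actM] := actL.
move=> y [l _ /XL_Omega /(OmegaL l)]; by rewrite -actM mulgV act1.
Qed.

(** For x in XL and k = kappa g x, the point g (l x) equals (l k^-1) (k g x) with k g x in XL. It is
    thus outside F XL only if l k^-1 is outside F, which happens for at most |k| b elements l of F;
    then integrate over x. *)
Lemma mu_thick_boundary g :
  mu (thick XL `\` aG g @^-1` thick XL) <= (b%:R * I_ g)%:E.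
Proof.
have [act1 actM] := actL; have [_ TV Tgen] := T'P.
have I_ge0 : (0 <= I_ g)%R.
  by rewrite -lee_fin (le_trans _ (I_P g))// integral_ge0// => x _; rewrite lee_fin.
pose B l := XL `\` (aL l \o aG g) @^-1` thick XL.
have mB l : measurable (B l).
  apply: measurableD => //; rewrite comp_preimage.
  by apply/measurable_actG/measurable_actL/measurable_thick.
apply: (@le_trans _ _ (\sum_(l <- F) mu (B l))).
  have sub : thick XL `\` aG g @^-1` thick XL `<=`
      [set y | exists2 l, l \in F & (aL l^-1%g @^-1` B l) y].
    move=> y [[l lF ly] ny]; exists l => //; split=> // ny'; apply: ny.
    by move: ny'; rewrite /= comm -actM mulgV act1.
  apply: (@le_trans _ _ (mu [set y | exists2 l, l \in F & (aL l^-1%g @^-1` B l) y])).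
    apply: le_measure => //; rewrite inE.
      by apply: measurableD; [|apply: measurable_actG]; apply: measurable_thick.
    by apply: measurable_exists_seq => l; apply: measurable_actL.
  apply: le_trans (measure_exists_seq_le _ _ _) _ => [l|].
    exact: measurable_actL.
  by apply: lee_sum => l _; rewrite mu_actL.
pose N x := count (fun l => x \in B l) F.
have N_le x : XL x -> (N x <= word_length T' (kappa g x) * b)%N.
  move=> XLx; rewrite -word_lengthV//.
  apply: leq_trans (bd_spelled uF Fb (spelled_length _ TV Tgen)).
  apply: sub_count => l /set_mem[_ nx]; apply/negP => lF; apply: nx.
  exists (l * (kappa g x)^-1)%g => //=.
  by rewrite invgM invgK -actM mulgVK; apply: kappaP.
have mN : measurable_fun XL ((fun x => (N x)%:R%:E) : T -> \bar R).
  under eq_fun do rewrite /N count_sum natr_sum -sumEFin.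
  apply: emeasurable_sum => l; apply/measurable_EFinP.
  rewrite (_ : (fun x => _) = \1_(B l)); first exact: measurable_indic.
  by apply/funext => x; rewrite indicE.
have -> : \sum_(l <- F) mu (B l) = \int[mu]_(x in XL) (N x)%:R%:E.
  under [RHS]eq_integral do rewrite /N count_sum natr_sum -sumEFin.
  rewrite ge0_integral_sum//; last first.
    move=> l; apply/measurable_EFinP; rewrite (_ : (fun x => _) = \1_(B l)).
      exact: measurable_indic.
    by apply/funext => x; rewrite indicE.
  apply: eq_bigr => l _.
  rewrite -[RHS]/(\int[mu]_(x in XL) (\1_(B l) x)%:E) integral_indic//.
  by congr (mu _); apply/seteqP; split=> x // [].
have [b0|b_gt0] := posnP b.
  rewrite b0 mul0r integral0_eq// => x XLx; rewrite (_ : N x = 0%N)//.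
  by apply/eqP; rewrite -leqn0 (leq_trans (N_le x XLx))// b0 muln0.
(* The word length of the cocycle is not known to be measurable, so the factor b is taken out of the
   integral of the measurable function N instead. *)
apply: (@le_trans _ _ (\int[mu]_(x in XL) (b%:R%:E * (b%:R^-1 * (N x)%:R)%:E))).
  rewrite le_eqVlt; apply/orP; left; apply/eqP; apply: eq_integral => x _.
  by rewrite -EFinM mulrA mulfV ?mul1r// pnatr_eq0 -lt0n.
have N0 x : 0 <= (b%:R^-1 * (N x)%:R)%:E :> \bar R.
  by rewrite lee_fin mulr_ge0// invr_ge0.
have mN' : measurable_fun XL ((fun x => (b%:R^-1 * (N x)%:R)%:E) : T -> \bar R).
  by apply/measurable_EFinP/measurable_funM => //; exact/measurable_EFinP.
rewrite ge0_integralZl_EFin//.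
rewrite EFinM; apply: lee_pmul => //.
  by apply: integral_ge0.
apply: le_trans (I_P g); apply: ge0_le_integral_sub => x XLx.
- exact: N0.
- by rewrite lee_fin.
- split=> //; rewrite lee_fin ler_pdivrMl ?ltr0n// -natrM ler_nat mulnC.
  exact: N_le.
Qed.

End Thickening.

(* The actions commute, so h (l^-1 (g^-1 x)) = (h g^-1) (l^-1 x) is in XG for
   at most one g once l and h are fixed. *)
Lemma hits_thick_le (F : seq L) (s0 s1 : seq G) (B Bbad : set T) x :
  uniq s1 ->
  (forall y, B y -> Bbad y \/ thick F (covered s0) y) ->
  (hits s1 B x <= hits s1 Bbad x + size F * size s0)%N.
Proof.
have [actG1 actGM] := actG.
move=> us1 BB.
pose P l h g := `[< XG (aG h (aL l^-1%g (aG g^-1%g x))) >].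
apply: (@leq_trans (hits s1 Bbad x + \sum_(l <- F) \sum_(h <- s0) count (P l h) s1)%N).
  under [X in (_ <= _ + X)%N]eq_bigr do under eq_bigr do rewrite count_sum.
  under [X in (_ <= _ + X)%N]eq_bigr do rewrite exchange_big/=.
  rewrite exchange_big/= /hits !count_sum -big_split/=; apply: leq_sum => g _.
  case: asboolP => //= /BB[bad|[l lF [h hs0 hP]]].
    by rewrite asboolT.
  have Pg : P l h g by apply/asboolP.
  by rewrite (big_rem _ lF)/= (big_rem _ hs0)/= Pg -addnA addnCA leq_addr.
rewrite leq_add2l -sum_seq_const; apply: leq_sum => l _.
rewrite -[leqRHS]muln1 -sum_seq_const; apply: leq_sum => h _.
apply: count_leq1 => // g g' _ _ /asboolP; rewrite -comm -actGM => gP.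
move=> /asboolP; rewrite -comm -actGM => g'P.
by apply: invg_inj; apply: mulgI (uniqG gP g'P).
Qed.

(* For the thickening W = F XL cut down to finitely many G-translates of XG, the
   sets of g with g^-1 x in W are Folner for some x in XG. Their size is only
   controlled on average, hence Wbad: the part of W coming from the small
   portion of XL that a fixed number of translates of XG does not cover. *)
Lemma strict_folner_dominated (S : seq G) (T' : set L) :
  (forall s, s \in S -> (s^-1)%g \in S) -> finite_symmetric_generating T' ->
  (forall g, \int[mu]_(x in XL) (word_length T' (kappa g x))%:R%:E < +oo) ->
  folner_dominated [set` S] T'.
Proof.
move=> SV T'P I_fin.
have [actG1 actGM] := actG.
pose I_ g := fine (\int[mu]_(x in XL) (word_length T' (kappa g x))%:R%:E).
have I_ge0 g : 0 <= \int[mu]_(x in XL) (word_length T' (kappa g x))%:R%:E.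
  by apply: integral_ge0 => x _; rewrite lee_fin.
have I_P g : \int[mu]_(x in XL) (word_length T' (kappa g x))%:R%:E <= (I_ g)%:E.
  by rewrite fineK// ge0_fin_numE.
pose c := fine (mu XL).
have cE : mu XL = c%:E by rewrite fineK// ge0_fin_numE// ltW.
have c_gt0 : (0 < c)%R by rewrite -lte_fin -cE.
pose Isum : R := (\sum_(g <- S) I_ g)%R.
have Isum_ge0 : (0 <= Isum)%R by apply: sumr_ge0 => g _; apply: fine_ge0.
have [s0 [us0 s0P]] : exists s : seq G, uniq s /\ mu (XL `\` covered s) <= (c / 8)%:E.
  by apply: exhaust => //; rewrite divr_gt0.
pose N := Num.bound (4 * Isum / c)%R.
have NP : (4 * Isum / c < N%:R)%R by rewrite archi_boundP// !mulr_ge0// invr_ge0 ltW.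
(* 2 * size s0 pays for the size of the new set and N for the integrals of the cocycle. *)
exists (2 * size s0 + N + 1)%N => [|n v]; first by rewrite addn1.
set C := (2 * size s0 + N + 1)%N.
have C_gt0 : (0 < C)%N by rewrite /C addn1.
have [->|n0] := posnP n.
  rewrite muln0 => -[F [_ /andP[F0 Fv] _]]; apply: folner0.
  by rewrite muln_gt0 C_gt0 (leq_trans F0 Fv).
move=> [F [uF /andP[F0 Fv] FT]].
have Cn0 : (0 < C * n)%N by rewrite muln_gt0 C_gt0.
pose b := (size F %/ (C * n))%N.
have Fb t : T' t -> (bd F t <= b)%N by move=> /FT; rewrite leq_divRL// mulnC.
have bC : (b * (C * n) <= size F)%N by apply: leq_divM.
pose delta := (c / (8 * (n * size S + 1)%:R))%R.
have delta_gt0 : (0 < delta)%R by rewrite divr_gt0// mulr_gt0// ltr0n addn1.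
pose W := thick F XL.
have mW : measurable W by apply: measurable_thick.
have muW : mu W = ((size F)%:R * c)%:E by rewrite mu_thick// cE.
have [s1 [us1 s1P]] : exists s : seq G, uniq s /\ mu (W `\` covered s) <= delta%:E.
  by apply: exhaust => //; [apply: thick_Omega|rewrite muW ltry].
have mcov s : measurable (covered s) by apply: measurable_covered.
pose W' := W `&` covered s1.
have mW' : measurable W' by apply: measurableI.
pose dW g := W' `\` aG g @^-1` W'.
have mdW g : measurable (dW g) by apply: measurableD => //; apply: measurable_actG.
pose Wbad := W' `&` thick F (XL `\` covered s0).
have mthick : measurable (thick F (XL `\` covered s0)).
  by apply: measurable_thick; apply: measurableD.
have mWbad : measurable Wbad by apply: measurableI.
have mu_dW g : mu (dW g) <= (b%:R * I_ g + delta)%:E.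
  have mA : measurable (W `\` aG g @^-1` W).
    by apply: measurableD => //; apply: measurable_actG.
  have mB : measurable (aG g @^-1` (W `\` covered s1)).
    by apply: measurable_actG; apply: measurableD.
  apply: (@le_trans _ _ (mu ((W `\` aG g @^-1` W) `|` aG g @^-1` (W `\` covered s1)))).
    apply: le_measure; rewrite ?inE//; first exact: measurableU.
    move=> y [[Wy _] nW'y]; have [Wgy|nWgy] := pselect (W (aG g y)); last by left.
    by right; split=> // cgy; apply: nW'y.
  apply: le_trans (measureU2 mu mA mB) _; rewrite EFinD; apply: leeD.
    exact: (mu_thick_boundary T'P I_P uF Fb).
  by rewrite [leLHS](mu_actG g (measurableD mW (mcov s1))).
have mu_Wbad : mu Wbad <= ((size F)%:R * (c / 8))%:E.
  apply: (@le_trans _ _ (mu (thick F (XL `\` covered s0)))).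
    by apply: le_measure; rewrite ?inE// => y [].
  apply: le_trans (mu_thick_le _ _) _; first exact: measurableD.
  by rewrite EFinM lee_pmul2l// lte_fin ltr0n.
have mu_W' : ((size F)%:R * c - delta)%:E <= mu W'.
  rewrite EFinB leeBlDr// -muW.
  apply: (@le_trans _ _ (mu (W' `|` (W `\` covered s1)))).
    apply: le_measure; rewrite ?inE//.
      by apply: measurableU => //; apply: measurableD.
    by move=> y Wy; have [cy|ncy] := pselect (covered s1 y); [left|right].
  apply: le_trans (measureU2 mu mW' (measurableD mW (mcov s1))) _.
  by apply: leeD.
(* Budget in units of |F| c: at most 1/4 from the boundary of F, 1/8 from all the errors delta, 1/4
   from twice [Wbad], against 1. *)
have [x [XGx lt_hits]] : exists x, XG x /\
    (n * \sum_(g <- S) hits s1 (dW g) x + 2 * hits s1 Wbad x < hits s1 W' x)%N.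
  apply: exists_hits_lt => //.
  - by move=> y [].
  - by move=> y [[]].
  - by move=> g y [[]].
  apply: lt_le_trans mu_W'.
  apply: (@le_lt_trans _ _ ((n%:R * (b%:R * Isum + (size S)%:R * delta) +
      2 * ((size F)%:R * (c / 8)))%R)%:E).
    rewrite EFinD; apply: leeD; last first.
      by rewrite mulrDl mul1r EFinD; apply: leeD.
    apply: (@le_trans _ _ (\sum_(i < n) \sum_(g <- S) (b%:R * I_ g + delta)%:E)).
      by apply: lee_sum => i _; apply: lee_sum => g _.
    under eq_bigr do rewrite sumEFin big_split/= -mulr_sumr.
    rewrite sumEFin lee_fin big_const_seq count_predT iter_addr_0.
    by rewrite big_const card_ord iter_addr_0 -[leLHS]mulr_natl -[(delta *+ _)%R]mulr_natl.
  have F1 : (1 <= (size F)%:R :> R)%R by rewrite ler1n.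
  have Fc : (c <= (size F)%:R * c)%R by rewrite ler_peMl// ltW.
  have deltaE : (n%:R * ((size S)%:R * delta) + delta = c / 8)%R.
    rewrite /delta natrD natrM; field.
    by rewrite -natrM natr1 pnatr_eq0.
  have Nc : (4 * Isum <= N%:R * c)%R by rewrite -ler_pdivrMr// ltW.
  have bn : (n%:R * (b%:R * (4 * Isum)) <= (size F)%:R * c)%R.
    rewrite mulrA -natrM.
    apply: (@le_trans _ _ ((n * b)%:R * (N%:R * c))%R); first by rewrite ler_wpM2l.
    rewrite mulrA -natrM ler_pM2r// ler_nat (leq_trans _ bC)//.
    rewrite [(n * b)%N]mulnC -mulnA leq_mul2l [(n * N)%N]mulnC leq_mul2r /C.
    by rewrite -addnA addnCA leq_addr !orbT.
  rewrite lte_fin mulrDr.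
  have -> : (n%:R * (b%:R * Isum) = n%:R * (b%:R * (4 * Isum)) / 4)%R by field.
  lra.
pose Fx := [seq g <- s1 | `[< W' (aG g^-1%g x) >]].
have szFx : size Fx = hits s1 W' x by rewrite size_filter.
exists Fx; split.
- by rewrite filter_uniq.
- rewrite szFx (leq_trans _ lt_hits)//=.
  have : (hits s1 W' x <= hits s1 Wbad x + size F * size s0)%N.
    apply: hits_thick_le => // y W'y; have [[l lF XLy] _] := W'y.
    have [cy|ncy] := pselect (covered s0 (aL l^-1%g y)).
      by right; exists l.
    by left; split=> //; exists l.
  have : (size F * size s0 <= v * size s0)%N by rewrite leq_mul2r Fv orbT.
  (* Fewer than half of the hits are bad, so the others, at most size F * size s0, are more than
     half. *)
  move=> Fv0 Whits; apply: (@leq_trans (2 * (v * size s0))).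
    move: lt_hits Whits Fv0; rewrite -/(hits s1 W' x).
    move: (n * _)%N (hits _ _ _) (hits _ _ _) (size F * _)%N (v * _)%N.
    clear; lia.
  by rewrite [(v * _)%N]mulnC mulnA leq_mul2r /C -addnA leq_addr orbT.
move=> t /= tS; rewrite szFx; apply: leq_trans (ltnW lt_hits).
apply: leq_trans (leq_addr _ _); rewrite leq_mul2l; apply/orP; right.
rewrite (big_rem _ (SV t tS))/=; apply: leq_trans (leq_addr _ _).
rewrite /bd /exits count_filter; apply: sub_count => g /= /andP[gt W'g].
apply/asboolP; split; first exact/asboolP.
rewrite /= -actGM -invgM => W'gt.
move/negP: gt; apply; rewrite mem_filter asboolT//=.
(* This is why W was cut to [W']: some h in s1 carries (g t)^-1 x into XG, and since x is in XG too,
   h = g t. *)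
have [_ [h hs1]] := W'gt; rewrite /= -actGM => hgt.
suff -> : (g * t)%g = h by [].
have := uniqG (x := x) (g := 1%g) _ hgt; rewrite actG1 => /(_ XGx) /esym /eqP.
by rewrite divg_eq1 => /eqP.
Qed.

End StrictCoupling.

Lemma enumerate_generated (G : groupType) (S : set G) :
  finite_symmetric_generating S -> exists e : nat -> G, forall g, exists n, e n = g.
Proof.
move=> [/finite_seqP[s ->] SV Sgen].
exists (fun n => if unpickle n is Some w then
  (\prod_(i <- w : seq nat) nth 1 s i)%g else 1%g) => g.
have [w [_ ws <-]] := spelled_length g SV Sgen.
exists (pickle (map (index^~ s) w)); rewrite pickleK big_map.
by rewrite !big_seq; apply: eq_bigr => x /ws xs; apply: nth_index.
Qed.

(** Both groups are countable, so the points whose joint orbit avoids a null set Z containing all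
    exceptions form a conull invariant set Omega, on which the coupling is strict. *)
Lemma L1_folner_dominated (R : realType) (G L : groupType) :
  L1_measure_equivalent R G L -> exists (S : set G) (T : set L),
    [/\ finite_symmetric_generating S, finite_symmetric_generating T
      & folner_dominated S T].
Proof.
move=> [c [S [T [SG TG L1G _]]]]; exists S, T; split=> //.
have [eG eGP] := enumerate_generated SG.
have [eL eLP] := enumerate_generated TG.
case: c L1G => /= dd X mu aG aL XG XL _ mu_neq0 actG actL comm freeG freeL mpG mpL.
move=> [mXG fundG] [mXL fundL] _ XL_fin L1G.
have [actG1 actGM] := actG; have [actL1 actLM] := actL.
have mactG g B : measurable B -> measurable (aG g @^-1` B).
  by move=> mB; have [mg _] := mpG g; rewrite -[X in measurable X]setTI; apply: mg.
have mactL g B : measurable B -> measurable (aL g @^-1` B).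
  by move=> mB; have [mg _] := mpL g; rewrite -[X in measurable X]setTI; apply: mg.
have [Z [mZ muZ ZP]] : exists Z : set X, [/\ measurable Z, mu Z = 0%E &
    forall x, ~ Z x -> [/\ forall g, g <> 1%g -> aG g x <> x,
      forall l, l <> 1%g -> aL l x <> x,
      exists! y, (orbit_of aG x `&` XG) y & exists! y, (orbit_of aL x `&` XL) y]].
  have := negligibleU (negligibleU freeG freeL) (negligibleU fundG fundL).
  move=> [Z [mZ muZ subZ]]; exists Z; split=> // x nZx.
  have nn := contra_not (@subZ x) nZx.
  split; apply: contrapT => nx; apply: nn; [left; left|left; right|right; left|right; right] => //.
pose Omega := [set x | forall g l, ~ Z (aG g (aL l x))].
have OmegaG g x : Omega x -> Omega (aG g x).
  by move=> Ox h l; rewrite -comm -actGM; apply: Ox.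
have OmegaL l x : Omega x -> Omega (aL l x).
  by move=> Ox h l'; rewrite -actLM; apply: Ox.
have OmegaGV g x : Omega (aG g x) -> Omega x.
  by move=> /(OmegaG g^-1%g); rewrite -actGM mulVg actG1.
have OmegaLV l x : Omega (aL l x) -> Omega x.
  by move=> /(OmegaL l^-1%g); rewrite -actLM mulVg actL1.
have OmegaZ x : Omega x -> ~ Z x.
  by move=> /(_ 1%g 1%g); rewrite actG1 actL1.
have OmegaC : ~` Omega = \bigcup_i \bigcup_j (aL (eL j) @^-1` (aG (eG i) @^-1` Z)).
  apply/seteqP; split=> x /=.
    move=> /existsNP[g] /existsNP[l] /contrapT Zgl.
    have [i ig] := eGP g; have [j jl] := eLP l.
    by exists i => //; exists j => //=; rewrite ig jl.
  by move=> [i _ [j _ Zij]]; apply/existsNP; exists (eG i); apply/existsNP; exists (eL j); apply.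
have mOmega : measurable Omega.
  rewrite -(setCK Omega); apply: measurableC; rewrite OmegaC.
  by apply: bigcupT_measurable => i; apply: bigcupT_measurable => j; apply/mactL/mactG.
have muOmegaC : mu (~` Omega) = 0%E.
  apply/negligibleP; first exact: measurableC.
  rewrite OmegaC; apply: negligible_bigcup => i; apply: negligible_bigcup => j.
  apply/negligibleP; first exact/mactL/mactG.
  apply: etrans ((mpL (eL j)).2 _ _) _; first exact/mactG.
  exact: etrans ((mpG (eG i)).2 _ mZ) muZ.
have coverG x : Omega x -> exists g, (XG `&` Omega) (aG g x).
  move=> Ox; have [_ _ [y [[[g _ gy] XGy] _]] _] := ZP x (OmegaZ x Ox).
  by exists g; split; [rewrite gy|apply: OmegaG].
have coverL x : Omega x -> exists l, (XL `&` Omega) (aL l x).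
  move=> Ox; have [_ _ _ [y [[[l _ ly] XLy] _]]] := ZP x (OmegaZ x Ox).
  by exists l; split; [rewrite ly|apply: OmegaL].
have uniqG x g g' : (XG `&` Omega) (aG g x) -> (XG `&` Omega) (aG g' x) -> g = g'.
  move=> [gX /OmegaGV Ox] [g'X _].
  have [free _ [y [_ yu]] _] := ZP x (OmegaZ x Ox).
  have gg' : aG g x = aG g' x.
    by rewrite -(yu (aG g x)) ?(yu (aG g' x))//; split=> //; [exists g'|exists g].
  rewrite -[g]mul1g -(mulVg g'^-1%g) invgK -mulgA.
  suff -> : (g'^-1 * g = 1)%g by rewrite mulg1.
  by apply: contrapT => /free; apply; rewrite actGM gg' -actGM mulVg actG1.
have uniqL x l l' : (XL `&` Omega) (aL l x) -> (XL `&` Omega) (aL l' x) -> l = l'.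
  move=> [lX /OmegaLV Ox] [l'X _].
  have [_ free _ [y [_ yu]]] := ZP x (OmegaZ x Ox).
  have ll' : aL l x = aL l' x.
    by rewrite -(yu (aL l x)) ?(yu (aL l' x))//; split=> //; [exists l'|exists l].
  rewrite -[l]mul1g -(mulVg l'^-1%g) invgK -mulgA.
  suff -> : (l'^-1 * l = 1)%g by rewrite mulg1.
  by apply: contrapT => /free; apply; rewrite actLM ll' -actLM mulVg actL1.
have mXG' : measurable (XG `&` Omega) by apply: measurableI.
have mXL' : measurable (XL `&` Omega) by apply: measurableI.
have kappaP g y : (XL `&` Omega) y ->
    (XL `&` Omega) (aL (cocycle aG aL XL g y) (aG g y)).
  move=> [_ /(OmegaG g) Oy]; have [l [lX _]] := coverL _ Oy.
  split; last exact: OmegaL.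
  have ind_in : (orbit_of aL (aG g y) `&` XL) (induced_action aG aL XL g y).
    by rewrite /induced_action; apply: xgetPex; exists (aL l (aG g y)); split=> //; exists l.
  have [[l' _ l'E] indX] := ind_in.
  rewrite /cocycle; case: xgetP => [l'' _ -> //|/(_ l')]; exact.
(* Otherwise countably many null translates would cover Omega and the whole space would be null. *)
have XL'_gt0 : (0 < mu (XL `&` Omega))%E.
  rewrite lt0e measure_ge0 andbT; apply/eqP => XL0.
  apply: mu_neq0; apply/negligibleP => //.
  apply: (negligibleS (A := ~` Omega `|` \bigcup_j (aL (eL j) @^-1` (XL `&` Omega)))).
    move=> x _; have [Ox|nOx] := pselect (Omega x); last by left.
    by right; have [l lX] := coverL x Ox; have [j jl] := eLP l; exists j; rewrite //= jl.
  apply: negligibleU; first by apply/negligibleP => //; exact: measurableC.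
  apply: negligible_bigcup => j; apply/negligibleP; first exact: mactL.
  exact: etrans ((mpL (eL j)).2 _ mXL') XL0.
have XL'_fin : (mu (XL `&` Omega) < +oo)%E.
  by apply: le_lt_trans XL_fin; apply: le_measure; rewrite ?inE// => x [].
have [/finite_seqP[s Ss] SV _] := SG.
rewrite Ss.
apply: (strict_folner_dominated actG actL comm mpG mpL mXG' mXL' _ OmegaL
  coverG uniqG uniqL XL'_gt0 XL'_fin eGP kappaP) => //.
- by move=> t ts; have := SV t; rewrite Ss; apply.
- move=> g; apply: le_lt_trans (L1G g).
  apply: ge0_le_integral_sub => x; rewrite ?lee_fin//.
  by move=> [].
Qed.

(** * Isoperimetry of wreath products *)

Lemma prod_leq_seq (T : eqType) (s : seq T) (u v : T -> nat) :
  (forall x, x \in s -> (u x <= v x)%N) ->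
  (\prod_(x <- s) u x <= \prod_(x <- s) v x)%N.
Proof. by move=> uv; rewrite !big_seq; apply: leq_prod. Qed.

Lemma prod_seq_const (T : Type) (s : seq T) c : (\prod_(x <- s) c = c ^ size s)%N.
Proof. by elim: s => [|x s IH]; rewrite ?big_nil// big_cons IH expnS. Qed.

(** The inequality of arithmetic and geometric means: the mean of u is at most size s. *)
Lemma prod_leq_sum_sqr (T : eqType) (s : seq T) (u : T -> nat) :
  (\sum_(x <- s) u x <= size s ^ 2)%N ->
  (\prod_(x <- s) u x <= size s ^ size s)%N.
Proof.
case: s => [|x0 s0]; first by rewrite !big_nil.
set s := x0 :: s0 => sum_u; set n := size s.
have := @leif_AGM rat 'I_n predT (fun i => (u (nth x0 s i))%:R)%R.
rewrite card_ord => /(_ (fun i _ => ler0n _ _)) [+ _].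
under eq_bigl do rewrite inE.
under [X in (_ <= (X / _) ^+ _)%R -> _]eq_bigl do rewrite inE.
rewrite -natr_prod -natr_sum.
rewrite -(big_mkord xpredT (fun i => u (nth x0 s i))).
rewrite -(big_mkord xpredT (fun i => u (nth x0 s i))).
rewrite -!(big_nth x0 xpredT u) => /le_trans-/(_ (n%:R ^+ n)%R).
rewrite -natrX ler_nat; apply; rewrite natrX.
rewrite lerXn2r ?nnegrE ?divr_ge0//.
rewrite ler_pdivrMr ?ltr0n// -natrM ler_nat.
by rewrite mulnn.
Qed.

Lemma sum_eq_uniq (T : eqType) (s : seq T) z : uniq s ->
  (\sum_(x <- s) (z == x) = (z \in s))%N.
Proof.
move=> us; rewrite -count_uniq_mem// count_sum.
by apply: eq_bigr => x _; rewrite /= eq_sym.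
Qed.

(** * Entropy of finite sets of configurations *)

Section Han.
Variables (X : eqType) (V : finType).
Implicit Types (f g h : X -> V) (E : seq (X -> V)) (x : X).

Definition close x f g : bool := `[< forall y, y != x -> f y = g y >].

Lemma closexx x f : close x f f. Proof. exact/asboolP. Qed.

Lemma close_sym x f g : close x f g = close x g f.
Proof. by apply/asboolP/asboolP => fg y /fg. Qed.

Lemma close_trans x f g h : close x f g -> close x g h -> close x f h.
Proof. by move=> /asboolP fg /asboolP gh; apply/asboolP => y yx; rewrite fg// gh. Qed.

Lemma close_inj x f g : close x f g -> f x = g x -> f = g.
Proof.
move=> /asboolP fg fgx; apply/funext => y.
by have [->//|/fg] := eqVneq y x.
Qed.

Definition line E x f : nat := count (close x f) E.

(* Han's inequality for the uniform distribution on E. *)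
Lemma prod_line_le E (J : seq X) : uniq E -> uniq J ->
  (\prod_(f <- E) \prod_(x <- J) line E x f <= size E ^ size E)%N.
Proof.
move=> + uJ; elim: J uJ E => [|x J IH] /= uJ E uE.
  rewrite big1 => [|f _]; last by rewrite big_nil.
  by case: (size E) => // n; rewrite expn_gt0.
move: uJ => /andP[xJ uJ].
(* Conditioning on the value at x. As x is not in J, lines in the directions of J stay inside one
   [Ev v], where the induction hypothesis applies. *)
pose Ev v := [seq f <- E | f x == v].
apply: (@leq_trans (\prod_(f <- E) (line E x f * size (Ev (f x))))).
  under eq_bigr do rewrite big_cons.
  rewrite !big_split/= leq_mul2l; apply/orP; right.
  rewrite (partition_big (fun f : X -> V => f x) xpredT)//=.
  rewrite [leqRHS](partition_big (fun f : X -> V => f x) xpredT)//=.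
  apply: leq_prod => v _.
  rewrite -[leqLHS]big_filter -[leqRHS]big_filter -/(Ev v).
  have IHv := IH uJ (Ev v) (filter_uniq _ uE).
  apply: (@leq_trans (\prod_(f <- Ev v) \prod_(y <- J) line (Ev v) y f)).
    apply: prod_leq_seq => f; rewrite mem_filter => /andP[/eqP fx _].
    apply: prod_leq_seq => y yJ; rewrite /line count_filter.
    apply: sub_count => g /= fg; rewrite fg -fx /=.
    have xy : x != y by apply: contraNneq xJ => ->.
    by move/asboolP : fg => /(_ x xy) ->.
  apply: leq_trans IHv _; rewrite -prod_seq_const.
  by apply: prod_leq_seq => f; rewrite mem_filter => /andP[/eqP ->].
(* The sum counts triples (f, h, g) with h on the line of f and g x = f x; the pair (h, g)
   determines f. *)
apply: prod_leq_sum_sqr.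
have -> : (size E ^ 2 = \sum_(h <- E) \sum_(g <- E) 1)%N.
  by rewrite !sum_seq_const muln1 mulnn.
apply: (@leq_trans (\sum_(h <- E) \sum_(g <- E)
    count (fun f => close x f h && (g x == f x)) E)).
  under [leqRHS]eq_bigr do under eq_bigr do rewrite count_sum.
  under [leqRHS]eq_bigr do rewrite exchange_big/=.
  rewrite exchange_big/=; apply: leq_sum => f _.
  rewrite /line size_filter !count_sum big_distrl/=; apply: leq_sum => h _.
  rewrite big_distrr/=; apply: leq_sum => g _.
  by rewrite mulnb.
apply: leq_sum => h _; apply: leq_sum => g _.
apply: count_leq1 => // f f' _ _ /andP[fh /eqP gf] /andP[f'h /eqP gf'].
apply: (@close_inj x); last by rewrite -gf.
by apply: close_trans fh _; rewrite close_sym.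
Qed.

(** At least half of the pairs (f, x) contribute a factor q or more to the product in Han's
    inequality; this half is the source of the square. *)
Lemma leq_size_of_long_lines E (J : seq X) q : uniq E -> uniq J ->
  (0 < size E)%N -> (0 < q)%N ->
  (2 * \sum_(x <- J) count (fun f => line E x f < q) E <= size J * size E)%N ->
  (q ^ size J <= size E ^ 2)%N.
Proof.
move=> uE uJ E0 q0 few.
rewrite -(leq_exp2r _ _ E0) -!expnM.
pose good := (\sum_(f <- E) \sum_(x <- J) (q <= line E x f))%N.
have good_ge : (size J * size E <= 2 * good)%N.
  have : (good + \sum_(x <- J) count (fun f => line E x f < q) E =
      size J * size E)%N.
    under eq_bigr do rewrite count_sum.
    rewrite exchange_big/= /good -big_split/= mulnC -sum_seq_const.
    apply: eq_bigr => f _; rewrite -big_split/= -[size J]muln1 -sum_seq_const.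
    by apply: eq_bigr => x _; rewrite ltnNge; case: leqP.
  lia.
apply: (@leq_trans (q ^ (2 * good))); first by rewrite leq_pexp2l.
rewrite ![(2 * _)%N]mulnC !expnM leq_exp2r//; apply: leq_trans (prod_line_le uE uJ).
rewrite /good expn_sum; apply: prod_leq_seq => f fE.
rewrite expn_sum; apply: leq_prod => x _.
case: (leqP q) => [le_q|_]; first by rewrite expn1.
rewrite /line -has_count.
by apply/hasP; exists f; rewrite ?closexx.
Qed.

End Han.

(** * Finite subsets of a lamplighter space over the integers *)

Section Wreath.
Variables (V : finType) (alpha beta : V -> V) .
Hypothesis connected : forall A : {set V}, A != finset.set0 ->
  (forall v, v \in A -> (alpha v \in A) && (beta v \in A)) -> A = [set: V]%SET.
Local Notation conf := (int -> V).
Implicit Types (f g : conf) (F : seq (conf * int)%type).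

Definition upd (f : conf) (x : int) (v : V) : conf :=
  fun y => if y == x then v else f y.

Definition shiftY (n : int) (y : conf * int) : conf * int :=
  (y.1, y.2 + n)%R.
Definition writeY (c : V -> V) (y : conf * int) : conf * int :=
  (upd y.1 y.2 (c (y.1 y.2)), y.2).

Definition slice F (x : int) : seq conf := [seq y.1 | y <- F & y.2 == x].

Lemma mem_slice F x f : (f \in slice F x) = ((f, x) \in F).
Proof.
apply/mapP/idP => [[[g y]] /=|fxF]; last by exists (f, x); rewrite ?mem_filter ?eqxx.
by rewrite mem_filter => /andP[/eqP /= <- yF ->].
Qed.

Lemma slice_uniq F x : uniq F -> uniq (slice F x).
Proof.
move=> uF; rewrite map_inj_in_uniq ?filter_uniq// => -[f y] [g z].
by rewrite !mem_filter /= => /andP[/eqP -> _] /andP[/eqP -> _] ->.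
Qed.

Lemma close_upd f x v : close x f (upd f x v).
Proof. by apply/asboolP => y yx; rewrite /upd (negbTE yx). Qed.

(** The short f close to a given g all lie on one line, which has fewer than q points of E. *)
Lemma short_lines_le (E Q : seq conf) x q : (0 < q)%N ->
  (\sum_(g <- Q) count (fun f => (line E x f < q) && close x f g) E
     <= q * size Q)%N.
Proof.
move=> q0; rewrite mulnC -sum_seq_const; apply: leq_sum => g _.
have [/hasP[f fE /andP[fq fg]]|] :=
    boolP (has (fun f => (line E x f < q) && close x f g) E); last first.
  by rewrite has_count -leqNgt leqn0 => /eqP ->.
apply: leq_trans (ltnW fq); apply: sub_count => h /andP[_ hg].
by apply: close_trans fg _; rewrite close_sym.
Qed.

(* A point f of E whose line is short either leaves P, or its line meets the
   boundary of P, or its line is contained in P and then contains at least q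
   points outside E. *)
Lemma short_lines (E P : seq conf) x q : uniq E -> uniq P -> (0 < q)%N ->
  (2 * q <= #|V|)%N ->
  (count (fun f => line E x f < q) E <=
   count (fun f => f \notin P) E + count (fun f => f \notin E) P +
   q * (count (fun f => upd f x (alpha (f x)) \notin P) P +
        count (fun f => upd f x (beta (f x)) \notin P) P))%N.
Proof.
move=> uE uP q0 qV.
pose Q c := [seq f <- P | upd f x (c (f x)) \notin P].
pose R := [seq g <- P | g \notin E].
pose short f := (line E x f < q)%N.
have le_sum (T : seq conf) (p : pred conf) :
    (forall f, f \in E -> short f -> p f -> has (close x f) T) ->
    (count (fun f => short f && p f) E <=
      \sum_(g <- T) count (fun f => short f && close x f g) E)%N.
  move=> pT; under eq_bigr do rewrite count_sum.
  rewrite exchange_big/= count_sum; apply: leq_sum_seq => f fE.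
  case: (boolP (short f)) => //= sf; case: (boolP (p f)) => //= pf.
  by rewrite -count_sum -has_count pT.
pose pa f := has (close x f) (Q alpha).
pose pb f := has (close x f) (Q beta).
pose full f := [&& f \in P, ~~ pa f & ~~ pb f].
have updE f v g : close x f g -> upd g x v = upd f x v.
  move=> /asboolP fg; apply/funext => y; rewrite /upd.
  by case: eqVneq => // /fg ->.
have upd_inj f : injective (upd f x).
  by move=> v w /(congr1 (@^~ x)); rewrite /upd eqxx.
(* The values v that keep [upd f x v] in P form a nonempty set stable under alpha and beta, hence
   all of V. *)
have full_in f v : full f -> upd f x v \in P.
  move=> /and3P[fP nfa nfb].
  have : v \in [set: V]%SET by rewrite inE.
  rewrite -(connected (A := [set w | upd f x w \in P]%SET)); first by rewrite inE.
    apply/finset.set0Pn; exists (f x); rewrite inE.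
    rewrite (_ : upd f x (f x) = f)//.
    by apply/funext => y; rewrite /upd; case: eqVneq => [->|].
  move=> w; rewrite !inE => wP; apply/andP; split; apply: contraT => nP.
    move/hasP: nfa; case; exists (upd f x w); last exact: close_upd.
    by rewrite mem_filter wP andbT (updE _ _ _ (close_upd _ _ _)) {2}/upd eqxx nP.
  move/hasP: nfb; case; exists (upd f x w); last exact: close_upd.
  by rewrite mem_filter wP andbT (updE _ _ _ (close_upd _ _ _)) {2}/upd eqxx nP.
have full_le : (count (fun f => short f && full f) E <= size R)%N.
  (* Double counting of pairs on a common line: a short full f sees at least q points of P outside
     E, and each of those sees at most q short f. *)
  rewrite -(leq_pmul2l q0); apply: leq_trans (short_lines_le E R x q0).
  under eq_bigr do rewrite count_sum.
  rewrite exchange_big/= count_sum big_distrr/=; apply: leq_sum_seq => f fE.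
  case: (boolP (_ && _)) => [/andP[sf ff]|_]; last by rewrite muln0.
  rewrite muln1; under eq_bigr do rewrite -/(short f) sf /=.
  rewrite -count_sum.
  have inE_lt : (#|[set v | upd f x v \in E]%SET| < q)%N.
    apply: leq_ltn_trans sf; rewrite cardE -count_predT.
    apply: (leq_count_inj (f := upd f x)); rewrite ?enum_uniq//.
      by move=> v w _ _ /upd_inj.
    by move=> v; rewrite mem_enum inE => -> _; rewrite close_upd.
  have notinE_ge : (q <= #|~: [set v | upd f x v \in E]%SET|)%N.
    have := cardsC [set v | upd f x v \in E]%SET.
    by move: inE_lt qV; lia.
  apply: leq_trans notinE_ge _; rewrite cardE -count_predT.
  apply: (leq_count_inj (f := upd f x)); rewrite ?enum_uniq//.
    by move=> v w _ _ /upd_inj.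
  by move=> v; rewrite mem_enum !inE => nE _; rewrite close_upd mem_filter nE full_in.
have split_short : (count short E <= count (fun f => f \notin P) E +
    (count (fun f => short f && full f) E +
    (count (fun f => short f && pa f) E +
     count (fun f => short f && pb f) E)))%N.
  rewrite !count_sum -!big_split/=; apply: leq_sum => f _; rewrite /full.
  by case: (short f); case: (f \in P); case: (pa f); case: (pb f).
have pale c : (count (fun f => short f && has (close x f) (Q c)) E <=
   q * count (fun f => upd f x (c (f x)) \notin P) P)%N.
  rewrite -[X in (q * X)%N]size_filter -/(Q c); apply: leq_trans (short_lines_le E _ x q0).
  by apply: le_sum.
apply: leq_trans split_short _; rewrite -addnA leq_add2l.
apply: leq_add; first by rewrite -[leqRHS]size_filter.
by rewrite mulnDr; apply: leq_add; apply: pale.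
Qed.

Lemma exits_shift F z n : uniq F ->
  (exits F (shiftY (z *+ n)) <= n * exits F (shiftY z))%N.
Proof.
move=> uF; elim: n => [|n IH].
  rewrite mulr0n mul0n leqNgt -has_count; apply/hasPn => -[f y] yF.
  by rewrite negbK /shiftY /= addr0.
rewrite mulSn -(@eq_exits _ _ (shiftY (z *+ n) \o shiftY z)).
  apply: leq_trans (exits_comp _ uF _) (leq_add _ IH) => //.
  by move=> [f x] [g y] [-> /addIr ->].
by move=> [f x]; rewrite /shiftY /= mulrS addrA.
Qed.

Lemma sum_count_slice F (L : seq int) (p : pred (conf * int)) : uniq L ->
  (\sum_(x <- L) count (fun f => p (f, x)) (slice F x) <= count p F)%N.
Proof.
move=> uL.
have E x : count (fun f => p (f, x)) (slice F x) =
    count (fun y => p y && (y.2 == x)) F.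
  rewrite count_map count_filter; apply: eq_count => -[f y] /=.
  by have [->|_] := eqVneq y x; rewrite ?andbF ?andbT.
under eq_bigr do rewrite E count_sum.
rewrite exchange_big/= count_sum; apply: leq_sum => y _.
case: (p y) => /=; last by rewrite big1.
by rewrite sum_eq_uniq// leq_b1.
Qed.

Lemma sum_size_slice F :
  (\sum_(x <- undup [seq y.2 | y <- F]) size (slice F x) = size F)%N.
Proof.
under eq_bigr do rewrite size_map size_filter count_sum.
rewrite exchange_big/= -[RHS]muln1 -sum_seq_const; apply: eq_big_seq => y yF.
by rewrite sum_eq_uniq ?undup_uniq// mem_undup map_f.
Qed.

(* Apply short_lines to a slice of F that is close to the r next slices. *)
Lemma wreath_lower_bound F q r : uniq F -> (0 < size F)%N -> (0 < q)%N ->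
  (2 * q <= #|V|)%N ->
  (2 * (r * (exits F (shiftY 1) + exits F (shiftY (-1))) +
     q * (exits F (writeY alpha) + exits F (writeY beta))) <= size F)%N ->
  (q ^ r <= size F ^ 2)%N.
Proof.
move=> uF F0 q0 qV small.
pose L := undup [seq y.2 | y <- F].
have uL : uniq L by apply: undup_uniq.
pose short x0 (i : nat) :=
  count (fun f => line (slice F x0) (x0 + i%:Z)%R f < q)%N (slice F x0).
(* For the slices at x0 and x0 + i, a point in one and not in the other is an exit under the shift
   by i or by -i, hence costs at most r unit shifts. *)
have short_le i : (i < r)%N -> (\sum_(x0 <- L) short x0 i <=
    r * (exits F (shiftY 1) + exits F (shiftY (-1))) +
    q * (exits F (writeY alpha) + exits F (writeY beta)))%N.
  move=> ir.
  pose P x0 := slice F (x0 + i%:Z)%R.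
  pose L' := [seq (x0 + i%:Z)%R | x0 <- L].
  have uL' : uniq L' by rewrite map_inj_uniq//; apply: addIr.
  have sumL' (u : int -> nat) :
      (\sum_(x0 <- L) u (x0 + i%:Z)%R = \sum_(x <- L') u x)%N.
    by rewrite big_map.
  apply: leq_trans (leq_sum _ (fun x0 _ => short_lines (x0 + i%:Z)%R
    (slice_uniq x0 uF) (slice_uniq (x0 + i%:Z)%R uF) q0 qV)) _.
  rewrite !big_split/= -big_distrr/= big_split/=; apply: leq_add; last first.
    rewrite leq_mul2l; apply/orP; right; apply: leq_add.
      rewrite (sumL' (fun x =>
        count (fun f => upd f x (alpha (f x)) \notin slice F x) (slice F x))).
      under eq_bigr do under eq_count do rewrite mem_slice.
      exact: (sum_count_slice F (fun y => writeY alpha y \notin F)).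
    rewrite (sumL' (fun x =>
      count (fun f => upd f x (beta (f x)) \notin slice F x) (slice F x))).
    under eq_bigr do under eq_count do rewrite mem_slice.
    exact: (sum_count_slice F (fun y => writeY beta y \notin F)).
  rewrite mulnDr; apply: leq_add.
    apply: (@leq_trans (exits F (shiftY (1 *+ i)))).
      under eq_bigr do under eq_count do rewrite mem_slice.
      rewrite natz.
      exact: (sum_count_slice F (fun y => shiftY i%:Z y \notin F)).
    apply: leq_trans (exits_shift _ _ uF) _.
    by rewrite leq_mul2r ltnW ?orbT.
  apply: (@leq_trans (exits F (shiftY ((-1) *+ i)))).
    rewrite mulNrn natz.
    rewrite [leqLHS](_ : _ = \sum_(x <- L')
      count (fun f => shiftY (- i%:Z)%R (f, x) \notin F) (slice F x))%N.
      exact: (sum_count_slice F (fun y => shiftY (- i%:Z) y \notin F)).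
    rewrite big_map; apply: eq_bigr => x _; apply: eq_count => f.
    by rewrite /shiftY /= addrK mem_slice.
  apply: leq_trans (exits_shift _ _ uF) _.
  by rewrite leq_mul2r ltnW ?orbT.
have [->|r0] := posnP r; first by rewrite expn0 expn_gt0 F0.
(* One slice must work for all r directions at once; the weight r makes the two sums comparable. *)
have [x0 [x0_le]] : exists x0,
    (2 * \sum_(i <- iota 0 r) short x0 i <= r * size (slice F x0))%N /\
    (0 < r * size (slice F x0))%N.
  apply: (@exists_leq_of_sum _ L); last first.
    by rewrite -big_distrr/= sum_size_slice muln_gt0 r0.
  rewrite -!big_distrr/= sum_size_slice exchange_big/=.
  apply: (@leq_trans (2 * \sum_(i <- iota 0 r) (
    r * (exits F (shiftY 1) + exits F (shiftY (-1))) +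
    q * (exits F (writeY alpha) + exits F (writeY beta)))))%N.
    rewrite leq_mul2l; apply: leq_sum_seq => i; rewrite mem_iota add0n.
    by move=> /andP[_ /short_le].
  by rewrite sum_seq_const size_iota mulnCA leq_mul2l small orbT.
rewrite muln_gt0 => /andP[_ x0_gt0].
pose J := [seq (x0 + i%:Z)%R | i <- iota 0 r].
have sJ : size J = r by rewrite size_map size_iota.
apply: (@leq_trans (size (slice F x0) ^ 2)).
  rewrite -sJ; apply: leq_size_of_long_lines => //.
  - exact: slice_uniq.
  - by rewrite map_inj_uniq ?iota_uniq// => i j /addrI [].
  - by rewrite sJ big_map.
by rewrite leq_exp2r// size_map size_filter count_size.
Qed.

End Wreath.

(* The superlevel sets of the fibre-counting function of [pi] are on average
   as good as F itself. *)
Lemma level_set (T Y : eqType) (pi : T -> Y) (I : eqType) (J : seq I)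
    (w : I -> nat) (phi : I -> T -> T) (psi : I -> Y -> Y) (F : seq T) :
  (forall i, i \in J -> injective (phi i)) ->
  (forall i x, i \in J -> pi (phi i x) = psi i (pi x)) ->
  uniq F -> (0 < size F)%N ->
  (\sum_(i <- J) w i * exits F (phi i) <= size F)%N ->
  exists E : seq Y, [/\ uniq E, (0 < size E <= size F)%N &
    (\sum_(i <- J) w i * exits E (psi i) <= size E)%N].
Proof.
move=> phi_inj pi_phi uF F0 small.
pose m y := count (fun x => pi x == y) F.
have m_le y : (m y <= size F)%N by apply: count_size.
pose Y0 := undup [seq pi x | x <- F].
have uY0 : uniq Y0 by apply: undup_uniq.
pose E s := [seq y <- Y0 | s < m y]%N.
have mem_E s y : (y \in E s) = (s < m y)%N.
  rewrite mem_filter; case: ltnP => //= ms; rewrite mem_undup.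
  have /hasP[x xF /eqP <-] : has (fun x => pi x == y) F.
    by rewrite has_count (leq_trans _ ms).
  exact: map_f.
have sum_lt (k : nat) : (k <= size F)%N ->
    (\sum_(s <- iota 0 (size F)) (s < k) = k)%N.
  move=> kF; rewrite -count_sum -size_filter -[RHS](size_iota 0); apply: perm_size.
  apply: uniq_perm; rewrite ?filter_uniq ?iota_uniq// => s.
  rewrite mem_filter !mem_iota !add0n /=; case: ltnP => //= sk.
  exact: leq_trans kF.
have sumE : (\sum_(s <- iota 0 (size F)) size (E s) = size F)%N.
  under eq_bigr do rewrite size_filter count_sum.
  rewrite exchange_big/=; under eq_bigr do rewrite sum_lt//.
  under eq_bigr do rewrite /m count_sum.
  rewrite exchange_big/= -[RHS]muln1 -sum_seq_const; apply: eq_big_seq => x xF.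
  by rewrite sum_eq_uniq// mem_undup map_f.
have exitsE i : i \in J ->
    (\sum_(s <- iota 0 (size F)) exits (E s) (psi i) <= exits F (phi i))%N.
  move=> iJ; rewrite /exits.
  have E1 s : count (fun x => psi i x \notin E s) (E s) =
     (\sum_(y <- Y0) ((s < m y) && (m (psi i y) <= s)))%N.
    rewrite count_filter count_sum; apply: eq_bigr => y _ /=.
    by rewrite mem_E -leqNgt andbC.
  under eq_bigr do rewrite E1.
  rewrite exchange_big/=.
  apply: (@leq_trans (\sum_(y <- Y0) count (fun x => (pi x == y) &&
      (phi i x \notin F)) F)).
    apply: leq_sum => y _.
    (* Points of a fibre that stay in F are injected by phi into the next fibre, so a drop of m
       along psi is paid for by exits of phi. *)
    have m_psi : (count (fun x => (pi x == y) && (phi i x \in F)) F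
        <= m (psi i y))%N.
      apply: (leq_count_inj (f := phi i)) => // [x x' _ _|x xF /andP[/eqP <- ->]].
        exact: phi_inj.
      by rewrite pi_phi// eqxx.
    have m_split : m y = (count (fun x => (pi x == y) && (phi i x \in F)) F +
        count (fun x => (pi x == y) && (phi i x \notin F)) F)%N.
      rewrite /m !count_sum -big_split/=; apply: eq_bigr => x _.
      by case: (_ == _); case: (_ \in _).
    have sum_diff : (\sum_(s <- iota 0 (size F)) ((s < m y) && (m (psi i y) <= s)) +
        m (psi i y) <= maxn (m y) (m (psi i y)))%N.
      rewrite -[leqRHS]sum_lt; last by rewrite geq_max !m_le.
      rewrite -[X in (_ + X <= _)%N]sum_lt// -big_split/=.
      by apply: leq_sum => s _; rewrite leq_max; case: (ltnP s (m y)) => _;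
        case: (ltnP s (m (psi i y))).
    move: m_psi m_split sum_diff; lia.
  under eq_bigr do rewrite count_sum.
  rewrite exchange_big/= count_sum; apply: leq_sum => x _.
  case: (_ \notin _); last by rewrite big1// => y _; rewrite andbF.
  by under eq_bigr do rewrite andbT; rewrite sum_eq_uniq// leq_b1.
have [s [s_le s_gt0]] : exists s,
    (\sum_(i <- J) w i * exits (E s) (psi i) <= size (E s))%N /\
    (0 < size (E s))%N.
  apply: (@exists_leq_of_sum _ (iota 0 (size F))); last by rewrite sumE.
  rewrite sumE exchange_big/=; apply: leq_trans small; apply: leq_sum_seq => i iJ.
  by rewrite -big_distrr/= leq_mul2l exitsE ?orbT.
exists (E s); split; rewrite ?filter_uniq ?s_gt0//=.
have [sF|sF] := ltnP s (size F).
  by rewrite -[leqRHS]sumE (big_rem s) ?mem_iota//= leq_addr.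
move: s_gt0; rewrite size_filter -has_count => /hasP[y _ /=].
by move=> /leq_trans/(_ (m_le y)); rewrite ltnNge sF.
Qed.

(** * The groups *)

Section Dihedral.
Variable n : nat.

(* The rotation subgroup is 'I_n.+3, so the order is 2(n + 3). *)
Definition dihedral : Type := ('I_n.+3 * bool)%type.

HB.instance Definition _ := Finite.copy dihedral ('I_n.+3 * bool)%type.

Definition dih_mul (x y : dihedral) : dihedral :=
  (x.1 + (if x.2 then - y.1 else y.1), x.2 (+) y.2)%R.
Definition dih_inv (x : dihedral) : dihedral :=
  ((if x.2 then x.1 else - x.1), x.2)%R.
Definition dih_one : dihedral := (0%R, false).

Lemma dih_mulA : associative dih_mul.
Proof.
move=> [x e] [y f] [z g]; rewrite /dih_mul /= addbA; congr (_, _).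
by case: e f => -[]; rewrite /= ?opprD ?opprK addrA.
Qed.

Lemma dih_mul1 : left_id dih_one dih_mul.
Proof. by move=> [x e]; rewrite /dih_mul /= add0r. Qed.

Lemma dih_mulg1 : right_id dih_one dih_mul.
Proof. by move=> [x []]; rewrite /dih_mul /= ?oppr0 addr0. Qed.

Lemma dih_mulV : left_inverse dih_one dih_inv dih_mul.
Proof. by move=> [x []]; rewrite /dih_mul /= ?addNr ?subrr. Qed.

Lemma dih_mulgV : right_inverse dih_one dih_inv dih_mul.
Proof. by move=> [x []]; rewrite /dih_mul /= subrr. Qed.

HB.instance Definition _ := isGroup.Build dihedral
  dih_mulA dih_mul1 dih_mulg1 dih_mulV dih_mulgV.

Definition dih_a : dihedral := (0%R, true).
Definition dih_b : dihedral := (1%R, true).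

Lemma dihM (x y : dihedral) :
  (x * y)%g = (x.1 + (if x.2 then - y.1 else y.1), x.2 (+) y.2)%R.
Proof. by []. Qed.

Lemma dihV (x : dihedral) : (x^-1)%g = ((if x.2 then x.1 else - x.1), x.2)%R.
Proof. by []. Qed.

Lemma dih_aK : (dih_a * dih_a = 1)%g.
Proof. by rewrite dihM /= oppr0 addr0. Qed.

Lemma dih_bK : (dih_b * dih_b = 1)%g.
Proof. by rewrite dihM /= subrr. Qed.

Lemma card_dihedral : #|{: dihedral}| = (2 * n.+3)%N.
Proof. by rewrite card_prod card_ord card_bool mulnC. Qed.

Lemma dih_commg_rot (x y : dihedral) : [~ x, y]%g.2 = false.
Proof.
by rewrite /commg /conjg !dihM !dihV /=; case: x.2; case: y.2.
Qed.

Lemma dih_rotC (x y : dihedral) : x.2 = false -> y.2 = false -> (x * y = y * x)%g.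
Proof. by rewrite !dihM => -> ->; rewrite addrC. Qed.

(** The commutator is the rotation by -2, nontrivial since the modulus is at least 3. *)
Lemma dih_commg_ab : [~ dih_a, dih_b]%g <> 1%g.
Proof.
move=> /(congr1 (fun x : dihedral => val x.1)).
rewrite /commg /conjg !dihM !dihV /= modn_small ?ltn_mod// subSS subn0.
rewrite !add0n !(modn_small (ltnSn n.+2)) subSnn !(@modn_small 1)//.
by rewrite (@modn_small 2)// modn_small ?modn_small//; lia.
Qed.

(** Multiplying by b and then a adds 1 to a rotation, and one more a reaches the reflections. *)
Lemma dih_connected (S : {set dihedral}) : S != finset.set0 ->
  (forall x, x \in S -> (x * dih_a \in S)%g && (x * dih_b \in S)%g) ->
  S = [set: dihedral]%SET.
Proof.
move=> /finset.set0Pn[[z e] zS] Sab.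
have zS' : (z, false) \in S.
  case: e zS => // /Sab/andP[+ _]; by rewrite dihM /= oppr0 addr0.
have allS k : ((z + k%:R)%R, false) \in S.
  elim: k => [|k /Sab/andP[_ /Sab/andP[]]]; first by rewrite addr0.
  by rewrite !dihM /= oppr0 addr0 -addrA -natr1.
apply/setP => -[w f]; rewrite inE.
have wS : (w, false) \in S.
  have := allS (val (w - z)%R).
  by rewrite natr_Zp addrC subrK.
by case: f => //; case/Sab/andP : wS; rewrite dihM /= addr0.
Qed.

End Dihedral.

Section Diagonal.
Variables (l m : nat -> nat) (A : pred nat).

(* A pair (s, n): s k i is the lamp of coordinate k at site i, and n is the
   position of the lamplighter. *)
Definition diag : Type := ((forall k, int -> dihedral (l k)) * int)%type.

HB.instance Definition _ := Choice.copy diag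
  ((forall k, int -> dihedral (l k)) * int)%type.

Implicit Types x y z : diag.

Definition diag_mul x y : diag :=
  (fun k i => (x.1 k i * y.1 k (i - x.2)%R)%g, (x.2 + y.2)%R).
Definition diag_inv x : diag :=
  (fun k i => ((x.1 k (i + x.2)%R)^-1)%g, (- x.2)%R).
Definition diag_one : diag := (fun k i => 1%g, 0%R).

Lemma diag_ext x y : (forall k i, x.1 k i = y.1 k i) -> x.2 = y.2 -> x = y.
Proof.
case: x y => [s n] [s' n'] /= ss' ->; congr (_, _).
by apply: functional_extensionality_dep => k; apply/funext => i.
Qed.

Lemma diag_mulA : associative diag_mul.
Proof.
move=> x y z; apply: diag_ext => /= [k i|]; last by rewrite addrA.
by rewrite mulgA opprD addrA.
Qed.

Lemma diag_mul1 : left_id diag_one diag_mul.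
Proof.
by move=> x; apply: diag_ext => /= [k i|]; rewrite ?mul1g ?subr0 ?add0r.
Qed.

Lemma diag_mulg1 : right_id diag_one diag_mul.
Proof. by move=> x; apply: diag_ext => /= [k i|]; rewrite ?mulg1 ?addr0. Qed.

Lemma diag_mulV : left_inverse diag_one diag_inv diag_mul.
Proof.
by move=> x; apply: diag_ext => /= [k i|]; rewrite ?opprK ?mulVg ?addNr.
Qed.

Lemma diag_mulgV : right_inverse diag_one diag_inv diag_mul.
Proof.
by move=> x; apply: diag_ext => /= [k i|]; rewrite ?subrK ?mulgV ?subrr.
Qed.

HB.instance Definition _ := isGroup.Build diag
  diag_mulA diag_mul1 diag_mulg1 diag_mulV diag_mulgV.

Lemma diagM1 x y k i : (x * y)%g.1 k i = (x.1 k i * y.1 k (i - x.2)%R)%g.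
Proof. by []. Qed.
Lemma diagM2 x y : (x * y)%g.2 = (x.2 + y.2)%R. Proof. by []. Qed.
Lemma diagV1 x k i : (x^-1)%g.1 k i = ((x.1 k (i + x.2)%R)^-1)%g. Proof. by []. Qed.
Lemma diagV2 x : (x^-1)%g.2 = (- x.2)%R. Proof. by []. Qed.

(** An absent coordinate keeps its place with trivial letters, so that all the groups lie in one
    ambient group independent of A. *)
Definition lamp_a k : dihedral (l k) := if A k then dih_a (l k) else 1%g.
Definition lamp_b k : dihedral (l k) := if A k then dih_b (l k) else 1%g.

Lemma lamp_aK k : (lamp_a k * lamp_a k = 1)%g.
Proof. by rewrite /lamp_a; case: ifP => _; rewrite ?dih_aK ?mulg1. Qed.
Lemma lamp_bK k : (lamp_b k * lamp_b k = 1)%g.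
Proof. by rewrite /lamp_b; case: ifP => _; rewrite ?dih_bK ?mulg1. Qed.

Definition diag_t (n : int) : diag := (fun k i => 1%g, n).
Definition diag_a : diag := (fun k i => if i == 0%R then lamp_a k else 1%g, 0%R).
Definition diag_b : diag :=
  (fun k i => if i == (m k)%:Z%R then lamp_b k else 1%g, 0%R).

Definition diag_gens : set diag :=
  [set x | x \in [:: diag_t 1; diag_t (-1); diag_a; diag_b]].

Definition in_Gamma : pred diag := mem (generated diag_gens).

Definition Gamma : Type := {x : diag | in_Gamma x}.

HB.instance Definition _ := [isSub of Gamma for @sval diag in_Gamma].
HB.instance Definition _ := [Choice of Gamma by <:].
HB.instance Definition _ := SubChoice_isSubGroup.Build diag in_Gamma Gamma
  (generated_group_closed diag_gens).

End Diagonal.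

Section Gamma.
Variables (l m : nat -> nat) (A : pred nat).
Local Notation G := (Gamma l m A).
Local Notation dgens := (@diag_gens l m A).
Implicit Types (x y z : diag l) (g h : G).

Lemma in_gens x : x \in [:: diag_t l 1; diag_t l (-1); diag_a l A; diag_b l m A] ->
  in_Gamma m A x.
Proof. by move=> xg; apply/mem_set; apply: (@sub_generated _ dgens). Qed.

Lemma diag_tD n n' : (diag_t l n * diag_t l n')%g = diag_t l (n + n')%R.
Proof. by apply: diag_ext => // k i; rewrite diagM1 mulg1. Qed.

Lemma in_Gamma1 : in_Gamma m A (1%g : diag l).
Proof. by have [] := @generated_group_closed _ dgens. Qed.

Lemma in_GammaM x y : in_Gamma m A x -> in_Gamma m A y -> in_Gamma m A (x * y)%g.
Proof. exact: (group_closedM (@generated_group_closed _ dgens)). Qed.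

Lemma in_Gamma_t n : in_Gamma m A (diag_t l n).
Proof.
have tn (e : int) : (e == 1%R) || (e == (-1)%R) ->
    forall k : nat, in_Gamma m A (diag_t l (e *+ k)%R).
  move=> eE; elim=> [|k IH]; first exact: in_Gamma1.
  rewrite mulrS -diag_tD; apply: in_GammaM => //; apply: in_gens.
  by case/orP: eE => /eqP->; rewrite !inE eqxx ?orbT.
case: n => n; first by have := tn 1%R isT n; rewrite natz.
by have := tn (-1)%R isT n.+1; rewrite mulNrn natz -NegzE.
Qed.

Definition gsh (n : int) : G := Sub (diag_t l n) (in_Gamma_t n).
Lemma in_Gamma_a : in_Gamma m A (diag_a l A).
Proof. by apply: in_gens; rewrite !inE eqxx !orbT. Qed.

Lemma in_Gamma_b : in_Gamma m A (diag_b l m A).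
Proof. by apply: in_gens; rewrite !inE eqxx !orbT. Qed.

Definition ga : G := Sub (diag_a l A) in_Gamma_a.
Definition gb : G := Sub (diag_b l m A) in_Gamma_b.

Definition letters : seq G := [:: gsh 1; gsh (-1); ga; gb].
Definition gens : set G := [set` letters].

Lemma diag_aK : (diag_a l A * diag_a l A = 1)%g.
Proof.
apply: diag_ext => // k i; rewrite diagM1 /= subr0.
by case: ifP => _; rewrite ?lamp_aK ?mulg1.
Qed.

Lemma diag_bK : (diag_b l m A * diag_b l m A = 1)%g.
Proof.
apply: diag_ext => // k i; rewrite diagM1 /= subr0.
by case: ifP => _; rewrite ?lamp_bK ?mulg1.
Qed.

Lemma gsh0 : gsh 0 = 1%g. Proof. exact: val_inj. Qed.

Lemma gshD n n' : (gsh n * gsh n')%g = gsh (n + n')%R.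
Proof. by apply: val_inj; rewrite valM diag_tD. Qed.

Lemma gshV n : ((gsh n)^-1)%g = gsh (- n)%R.
Proof. by apply: mulg1_eq; rewrite gshD subrr gsh0. Qed.

Lemma gaV : (ga^-1)%g = ga.
Proof. by apply: mulg1_eq; apply: val_inj; rewrite valM diag_aK. Qed.

Lemma gbV : (gb^-1)%g = gb.
Proof. by apply: mulg1_eq; apply: val_inj; rewrite valM diag_bK. Qed.

Lemma gens_symmetric_generating : finite_symmetric_generating gens.
Proof.
split; first exact: finite_seq.
  move=> s; rewrite /gens/letters /= !inE => /or4P[] /eqP ->.
  - by rewrite gshV eqxx orbT.
  - by rewrite gshV opprK eqxx.
  - by rewrite gaV eqxx !orbT.
  - by rewrite gbV eqxx !orbT.
apply/seteqP; split=> // g _.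
have : generated dgens (val g) by apply/set_mem/valP.
pose H := [set x : diag l | exists h : G, val h = x /\ generated gens h].
have HG : group_closed (mem H).
  have [H1 HF] := @generated_group_closed _ gens.
  split=> [|x y /set_mem[h [<- hG]] /set_mem[h' [<- hG']]]; apply/mem_set.
    by exists 1%g; split=> //; apply/set_mem.
  exists (h * h'^-1)%g; split => //; apply/set_mem.
  by apply: HF; apply/mem_set.
move=> /(generated_min HG)[|h [/val_inj <- //]].
move=> x; rewrite /diag_gens /= !inE => /or4P[] /eqP ->.
- by exists (gsh 1%R); split=> //; apply: sub_generated; rewrite /gens/= !inE eqxx.
- by exists (gsh (-1)%R); split=> //; apply: sub_generated; rewrite /gens/= !inE eqxx orbT.
- by exists ga; split=> //; apply: sub_generated; rewrite /gens/= !inE eqxx !orbT.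
- by exists gb; split=> //; apply: sub_generated; rewrite /gens/= !inE eqxx !orbT.
Qed.

Lemma Gamma_finitely_generated : finitely_generated G.
Proof. by have [fin _ gen] := gens_symmetric_generating; exists gens. Qed.

Definition pos (g : G) : int := (val g).2.

Lemma posM g h : pos (g * h)%g = (pos g + pos h)%R.
Proof. by rewrite /pos valM. Qed.

Lemma posV g : pos (g^-1)%g = (- pos g)%R.
Proof. by apply/eqP; rewrite -addr_eq0 -posM mulVg. Qed.

(* In coordinate k, this conjugate of gb writes at the current position. *)
Definition gb_at k : G := (gsh (- (m k)%:Z) * (gb * gsh (m k)%:Z))%g.

Lemma gb_atE k g i : (val (g * gb_at k)%g).1 k i =
  ((val g).1 k i * (if i == pos g then lamp_b l A k else 1))%g.
Proof.
rewrite valM diagM1 -/(pos g); congr (_ * _)%g.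
rewrite !valM !diagM1 /= mul1g mulg1 opprK.
by rewrite addrC -subr_eq0 addrAC subrr add0r subr_eq0.
Qed.

Lemma gb_atV k : ((gb_at k)^-1)%g = gb_at k.
Proof. by rewrite /gb_at !invgM !gshV gbV opprK mulgA. Qed.

Lemma pos_gb_at k : pos (gb_at k) = 0%R.
Proof. by rewrite !posM /pos /= add0r addNr. Qed.

Lemma derived1_pos : @derived_series G 1 `<=` [set g | pos g = 0%R].
Proof.
apply: generated_min => [|_ [g _ [h _ <-]] /=].
  split=> [|g h /set_mem/= g0 /set_mem/= h0]; apply/mem_set => //=.
  by rewrite posM posV g0 h0.
by rewrite !posM !posV addrA addrACA addNr add0r addrC subrr.
Qed.

(** At position 0 commutators are computed site by site, and commutators in a dihedral group are
    rotations. *)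
Lemma derived2_rot : @derived_series G 2 `<=`
  [set g | pos g = 0%R /\ forall k i, ((val g).1 k i).2 = false].
Proof.
apply: generated_min => [|_ [g /derived1_pos/= g0 [h /derived1_pos/= h0 <-]] /=].
  split=> [|g h /set_mem[g0 gr] /set_mem[h0 hr]]; apply/mem_set; split=> //.
    by rewrite posM posV g0 h0 subr0.
  move=> k i; have -> : val (g * h^-1)%g = (val g * (val h)^-1)%g.
    exact: (gmulfF (val : G -> diag l)).
  by rewrite diagM1 dihM /= gr hr.
split; first by rewrite !posM !posV g0 h0.
move=> k i; have E : (val [~ g, h]%g).1 k i =
    [~ (val g).1 k i, (val h).1 k i]%g.
  rewrite (gmulfR (val : G -> diag l)) /commg /conjg !diagM1 !diagV1.
  rewrite ?diagM2 ?diagV2 -/(pos g) -/(pos h) g0 h0.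
  by rewrite !(subr0, addr0, oppr0).
by have := dih_commg_rot ((val g).1 k i) ((val h).1 k i); rewrite -E.
Qed.

Lemma derived3_trivial : @derived_series G 3 = [set 1%g].
Proof.
apply/seteqP; split; last first.
  move=> _ ->; exact/set_mem/(generated_group_closed _).1.
apply: generated_min => [|_ [g /derived2_rot/=[g0 gr] [h /derived2_rot/=[h0 hr] <-]] /=].
  split=> [|g h /set_mem/= -> /set_mem/= ->]; apply/mem_set => //=.
  by rewrite mulgV.
apply/eqP/commgP; apply: val_inj; rewrite !valM; apply: diag_ext.
  move=> k i; rewrite !diagM1 -/(pos g) -/(pos h) g0 h0 subr0.
  exact: dih_rotC.
by rewrite !diagM2 addrC.
Qed.

Lemma derived2_nontrivial k : A k -> @derived_series G 2 <> [set 1%g].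
Proof.
move=> Ak d2.
(* In coordinate k the inner commutators are supported at the sites -1, 0 and 0, 1; they meet only
   at 0, with the lamps a and b. *)
have : @derived_series G 2 [~ [~ gsh 1, ga], [~ gsh (-1), gb_at k]]%g.
  apply: sub_generated; exists [~ gsh 1, ga]%g => //.
    by apply: sub_generated; exists (gsh 1) => //; exists ga.
  exists [~ gsh (-1), gb_at k]%g => //.
  by apply: sub_generated; exists (gsh (-1)%R) => //; exists (gb_at k).
rewrite d2 => /(congr1 (fun g : G => (val g).1 k 0%R)).
have at0 g h : pos g = 0%R -> pos h = 0%R -> (val [~ g, h]%g).1 k 0%R =
    [~ (val g).1 k 0%R, (val h).1 k 0%R]%g.
  move=> g0 h0.
  rewrite (gmulfR (val : G -> diag l)) /commg /conjg !diagM1 !diagV1.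
  rewrite ?diagM2 ?diagV2 -/(pos g) -/(pos h) g0 h0.
  by rewrite !(subr0, addr0, oppr0).
have posR g h : pos [~ g, h]%g = 0%R.
  by rewrite !posM !posV addrA addrACA addNr add0r addrC subrr.
rewrite at0//.
have -> : (val [~ gsh 1, ga]%g).1 k 0%R = dih_a (l k).
  rewrite /commg /conjg gshV gaV.
  change ((diag_t l (-1) * (diag_a l A * (diag_t l 1 * diag_a l A)))%g.1 k 0%R =
    dih_a (l k)).
  by rewrite !diagM1 /= /lamp_a Ak !mul1g.
have -> : (val [~ gsh (-1), gb_at k]%g).1 k 0%R = dih_b (l k).
  have p0 : pos (gb_at k ^ gsh (-1))%g = 0%R.
    by rewrite conjgE posM posV posM pos_gb_at add0r addNr.
  have b'1 : (val (gb_at k)).1 k (- 1)%R = 1%g.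
    by have := gb_atE k 1%g (- 1)%R; rewrite !mul1g.
  rewrite commgEr gb_atV gb_atE p0 eqxx /lamp_b Ak conjgE gshV.
  by rewrite valM diagM1 valM diagM1 (_ : (0 - _)%R = (- 1)%R)// b'1 !mul1g.
exact: dih_commg_ab.
Qed.

Lemma Gamma_step_solvable k : A k -> step_solvable G 3.
Proof.
move=> Ak; split; first exact: derived3_trivial.
have sub1 n : @derived_series G n 1%g.
  by case: n => //= n; apply/set_mem/(generated_group_closed _).1.
have next n : @derived_series G n = [set 1%g] -> @derived_series G n.+1 = [set 1%g].
  move=> dn; apply/seteqP; split; last by move=> _ ->; apply: sub1.
  apply: generated_min => [|_ [g dg [h dh <-]]].
    split=> [|g h /set_mem/= -> /set_mem/= ->]; apply/mem_set => //=.
    by rewrite mulgV.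
  have {}dg : @derived_series G n g by [].
  have {}dh : @derived_series G n h by [].
  by move: dg dh; rewrite dn => -> ->; rewrite /= commgg.
by move=> [|[|[|]]]// _ => [/next/next|/next|]; apply: derived2_nontrivial Ak.
Qed.

End Gamma.

(** * Lower bound for Folner sets *)

Section LowerBound.
Variables (l m : nat -> nat) (A : pred nat).
Local Notation G := (Gamma l m A).
Local Notation gsh := (@gsh l m A).
Local Notation ga := (@ga l m A).
Local Notation gb := (@gb l m A).
Local Notation gens := (@gens l m A).
Implicit Types (F : seq G).

Lemma gens_gsh1 : gens (gsh 1%R).
Proof. by rewrite /gens /= !inE eqxx. Qed.
Lemma gens_gshN1 : gens (gsh (-1)%R).
Proof. by rewrite /gens /= !inE eqxx orbT. Qed.
Lemma gens_ga : gens ga.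
Proof. by rewrite /gens /= !inE eqxx !orbT. Qed.
Lemma gens_gb : gens gb.
Proof. by rewrite /gens /= !inE eqxx !orbT. Qed.

Lemma bd_gsh F z n : uniq F -> (bd F (gsh (z *+ n)%R) <= n * bd F (gsh z))%N.
Proof.
move=> uF; elim: n => [|n IH]; first by rewrite mulr0n gsh0 bd1.
rewrite mulrS -gshD mulSn; apply: leq_trans (bdM _ _ uF) _.
by rewrite leq_add2l.
Qed.

(** Coordinate k turns right multiplication by t, a and [gb_at] into the shifts and writes of a
    lamplighter, to which [level_set] carries the boundary bounds. The term 2 * m k + 2 adds the
    lengths 2 m_k + 1 of [gb_at] and 1 of a. *)
Lemma Gamma_folner_lower k N v q r : A k -> (0 < q)%N -> (q <= (l k).+3)%N ->
  (2 * (2 * r + q * (2 * m k + 2)) <= N)%N ->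
  folner gens N v -> (q ^ r <= v ^ 2)%N.
Proof.
move=> Ak q0 ql N_ge [F [uF /andP[F0 Fv] FN]].
have N0 : (0 < N)%N by apply: leq_trans N_ge; rewrite !muln_gt0 addn_gt0 !muln_gt0 q0 addn2 orbT.
pose b := (size F %/ N)%N.
have Fb s : gens s -> (bd F s <= b)%N.
  by move=> /FN; rewrite leq_divRL// mulnC.
have bt := Fb _ gens_gsh1; have bt' := Fb _ gens_gshN1.
have ba := Fb _ gens_ga; have bb := Fb _ gens_gb.
have bb' : (bd F (gb_at l m A k) <= (2 * m k + 1) * b)%N.
  apply: leq_trans (bdM _ _ uF) _.
  have bm := bd_gsh 1%R (m k) uF; rewrite natz in bm.
  have bm' := bd_gsh (-1)%R (m k) uF; rewrite mulNrn natz in bm'.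
  have -> : ((2 * m k + 1) * b = m k * b + (b + m k * b))%N by lia.
  apply: leq_add; first by apply: leq_trans bm' _; rewrite leq_mul2l bt' orbT.
  apply: leq_trans (bdM _ _ uF) _; apply: leq_add => //.
  by apply: leq_trans bm _; rewrite leq_mul2l bt orbT.
pose Y := ((int -> dihedral (l k)) * int)%type.
pose pi (g : G) : Y := ((val g).1 k, pos g).
pose phi i (g : G) : G :=
  (g * nth 1 [:: gsh 1%R; gsh (-1)%R; ga; gb_at l m A k] i)%g.
pose psi i : Y -> Y := nth id [:: @shiftY (dihedral (l k) : finType) 1%R;
  @shiftY (dihedral (l k) : finType) (-1)%R;
  writeY (fun d : dihedral (l k) => d * dih_a (l k))%g;
  writeY (fun d : dihedral (l k) => d * dih_b (l k))%g] i.
(* The weights in the hypothesis of [wreath_lower_bound]. *)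
pose w i := nth 0 [:: 2 * r; 2 * r; 2 * q; 2 * q]%N i.
have [|||||E [uE /andP[E0 EF] E_le]] :=
    @level_set G Y pi nat (iota 0 4) w phi psi F.
- by move=> i _; apply: mulIg.
- move=> i g; rewrite mem_iota => /andP[_].
  have upd_eq (c : dihedral (l k)) (h : G) : pos h = 0%R ->
      (forall j, (val (g * h)%g).1 k j =
        ((val g).1 k j * if j == pos g then c else 1)%g) ->
      pi (g * h)%g = writeY (fun d : dihedral (l k) => d * c)%g (pi g).
    move=> h0 hE; rewrite /pi /writeY /= posM h0 addr0; congr (_, _).
    apply/funext => j; rewrite -[LHS]/((val (g * h)%g).1 k j) hE /upd.
    by case: eqVneq => [->|]; rewrite ?mulg1.
  have shift_eq n : pi (g * gsh n)%g = shiftY n (pi g).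
    rewrite /pi /shiftY /= posM; congr (_, _); apply/funext => j.
    by rewrite -[LHS]/((val (g * gsh n)%g).1 k j) valM diagM1 mulg1.
  case: i => [|[|[|[|]]]]// _.
  + exact: shift_eq.
  + exact: shift_eq.
  + apply: upd_eq => // j; rewrite valM diagM1 -/(pos g) /= subr_eq0.
    by rewrite /lamp_a Ak.
  + apply: upd_eq => [|j]; first exact: pos_gb_at.
    by rewrite gb_atE /lamp_b Ak.
- exact: uF.
- exact: F0.
- rewrite /= !big_cons big_nil /w /=.
  apply: leq_trans (leq_divM (size F) N); rewrite -/b.
  apply: (@leq_trans (b * (2 * (2 * r + q * (2 * m k + 2))))); last first.
    by rewrite leq_mul2l N_ge orbT.
  have -> : (b * (2 * (2 * r + q * (2 * m k + 2))) = 2 * r * b + (2 * r * b +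
      (2 * q * b + (2 * q * ((2 * m k + 1) * b) + 0))))%N by lia.
  by do 4?[apply: leq_add]; rewrite ?leq_mul2l -/(bd F _) ?bt ?bt' ?ba ?bb' ?orbT.
apply: (@leq_trans (size E ^ 2)); last first.
  by rewrite leq_exp2r// (leq_trans EF).
apply: (wreath_lower_bound (@dih_connected (l k)) uE E0 q0).
  by rewrite card_dihedral leq_mul2l ql orbT.
apply: leq_trans E_le; rewrite /= !big_cons big_nil /w /=.
by rewrite !mulnDr !mulnA -!addnA addn0.
Qed.

End LowerBound.

(** * Folner sets supported in a window *)

Section Window.
Variables (l m : nat -> nat) (A : pred nat).
Local Notation G := (Gamma l m A).
Local Notation gsh := (@gsh l m A).
Local Notation ga := (@ga l m A).
Local Notation gb := (@gb l m A).
Local Notation gens := (@gens l m A).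
Local Notation la := (lamp_a l A).
Local Notation lb := (lamp_b l A).

Section Fixed.
Variables (lo : int) (W K M : nat).
Hypothesis far : forall k, (K <= k)%N -> (W <= m k)%N \/ ~~ A k.
Hypothesis near : forall k, (k < K)%N -> (m k <= M)%N.

Definition win (N : nat) (i : int) : bool := ((lo <= i) && (i < lo + N%:Z))%R.

Definition lit k (d : dihedral (l k)) (c : bool) : dihedral (l k) :=
  if c then d else 1%g.

(* In a coordinate k >= K the letters a and b read inside the window write at
   disjoint sets of sites, so that only the parities u and v of their numbers
   matter; in a coordinate k < K only the support is recorded. *)
Definition in_window (g : G) : Prop :=
  [/\ win W (pos g),
    exists u v : int -> bool, forall k i, (K <= k)%N ->
      (val g).1 k i = (lit (la k) (win W i && u i) *
        lit (lb k) (win W (i - (m k)%:Z)%R && v (i - (m k)%:Z)%R))%g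
    & forall k i, (k < K)%N -> ~~ win (W + M) i -> (val g).1 k i = 1%g].

Lemma win_off k i : (W <= m k)%N -> win W i -> win W (i - (m k)%:Z)%R = false.
Proof. rewrite /win => Wm; lia. Qed.

Lemma win_off' k i : (W <= m k)%N -> win W (i - (m k)%:Z)%R -> win W i = false.
Proof. rewrite /win => Wm; lia. Qed.

Lemma in_window_shift g n : in_window g -> win W (pos g + n)%R ->
  in_window (g * gsh n)%g.
Proof.
move=> [_ [u [v uv]] gK] gn; split; first by rewrite posM.
  by exists u, v => k i kK; rewrite valM diagM1 mulg1 uv.
by move=> k i kK iW; rewrite valM diagM1 mulg1 gK.
Qed.

Lemma in_window_a g : in_window g -> in_window (g * ga)%g.
Proof.
move=> [gW [u [v uv]] gK]; split; first by rewrite posM addr0.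
  exists (fun i => u i (+) (i == pos g)), v => k i kK.
  rewrite valM diagM1 uv// -/(pos g) /= subr_eq0.
  have [->|_] := eqVneq i (pos g); last by rewrite mulg1 addbF.
  rewrite gW /= addbT.
  have [Wm|nA] := far kK.
    by rewrite win_off//= mulg1 /lit /= mulg1; case: (u _); rewrite ?lamp_aK ?mul1g.
  by rewrite /lit /lamp_a /lamp_b (negbTE nA) !if_same !mulg1.
move=> k i kK iW; rewrite valM diagM1 gK// mul1g -/(pos g) /= subr_eq0.
case: eqVneq => // ig; move: iW gW; rewrite ig /win; lia.
Qed.

Lemma in_window_b g : in_window g -> in_window (g * gb)%g.
Proof.
move=> [gW [u [v uv]] gK]; split; first by rewrite posM addr0.
  exists u, (fun i => v i (+) (i == pos g)) => k i kK.
  rewrite valM diagM1 uv// -/(pos g) /= subr_eq.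
  rewrite [X in _ (+) X](_ : _ = (i == (m k)%:Z + pos g)%R); last first.
    by rewrite subr_eq addrC.
  have [->|_] := eqVneq i ((m k)%:Z + pos g)%R; last by rewrite mulg1 addbF.
  rewrite [((m k)%:Z + pos g - (m k)%:Z)%R](_ : _ = pos g); last by lia.
  rewrite gW /= addbT.
  have [Wm|nA] := far kK; last first.
    by rewrite /lit /lamp_a /lamp_b (negbTE nA) !if_same !mulg1.
  rewrite (@win_off' k)//=; last by rewrite [X in win W X](_ : _ = pos g)//; lia.
  by rewrite /lit /= !mul1g; case: (v _); rewrite ?lamp_bK ?mul1g.
move=> k i kK iW; rewrite valM diagM1 gK// mul1g -/(pos g) /= subr_eq.
case: eqVneq => // ig; move: iW gW (near kK); rewrite ig /win; lia.
Qed.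

Definition ext (N : nat) (T : Type) (f : 'I_N -> T) (d : T) (i : int) : T :=
  if [pick j : 'I_N | (lo + j%:Z == i)%R] is Some j then f j else d.

Lemma extE N T (f : int -> T) d i : (~~ win N i -> f i = d) ->
  ext (fun j : 'I_N => f (lo + j%:Z)%R) d i = f i.
Proof.
move=> fd; rewrite /ext; case: pickP => [j /eqP -> //|noj].
rewrite fd//; apply/negP => /andP[loi iN].
have jN : (`|i - lo| < N)%N by move: loi iN; lia.
by have := noj (Ordinal jN); rewrite /= => /eqP; apply; lia.
Qed.

(** Two parity functions, the lamps of the near coordinates and the position. Near lamps need W + M
    sites because b writes up to M to the right of the window. *)
Definition window_code : finType :=
  (({ffun 'I_W -> bool} * {ffun 'I_W -> bool}) *
   ({dffun forall k : 'I_K, {ffun 'I_(W + M) -> dihedral (l k)}} * 'I_W))%type.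

Definition window_decode (c : window_code) : diag l :=
  (fun k i => match @idP (k < K)%N with
    | ReflectT kK => ext (c.2.1 (Ordinal kK)) 1%g i
    | ReflectF _ => (lit (la k) (ext c.1.1 false i) *
                     lit (lb k) (ext c.1.2 false (i - (m k)%:Z)%R))%g
    end, (lo + (c.2.2 : nat)%:Z)%R).

Lemma in_window_decode g : in_window g -> exists c, window_decode c = val g.
Proof.
move=> [/andP[lo_g g_lo] [u [v uv]] gK].
have pW : (`|pos g - lo| < W)%N by move: lo_g g_lo; lia.
pose cu : {ffun 'I_W -> bool} := [ffun j : 'I_W => u (lo + j%:Z)%R].
pose cv : {ffun 'I_W -> bool} := [ffun j : 'I_W => v (lo + j%:Z)%R].
pose cl : {dffun forall k : 'I_K, {ffun 'I_(W + M) -> dihedral (l k)}} :=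
  [ffun k : 'I_K => [ffun j : 'I_(W + M) => (val g).1 k (lo + j%:Z)%R]
    : {ffun 'I_(W + M) -> dihedral (l k)}].
exists (cu, cv, (cl, Ordinal pW)); apply: diag_ext => [k i|/=]; last first.
  by rewrite -/(pos g); move: lo_g; lia.
rewrite /=; case: {-}_ / idP => [kK|/negP]; last first.
  rewrite -leqNgt => kK; rewrite uv//.
  have extw (f : int -> bool) (h : {ffun 'I_W -> bool}) j :
      (forall j' : 'I_W, h j' = f (lo + j'%:Z)%R) ->
      ext h false j = win W j && f j.
    move=> hf; rewrite -(@extE W _ (fun j => win W j && f j) false) => [|/negbTE->//].
    rewrite /ext; case: pickP => // j' _; rewrite hf /win.
    by have := ltn_ord j'; case: (f _); rewrite ?andbF// andbT; lia.
  by rewrite (extw u)?(extw v)// => j; rewrite ffunE.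
rewrite -(@extE (W + M) _ ((val g).1 k) 1%g); last by move=> iW; apply: gK.
by rewrite /ext; case: pickP => // j _; rewrite /cl !ffunE.
Qed.

Lemma card_code : #|window_code| =
  (2 ^ W * 2 ^ W * (\prod_(k < K) (2 * (l k).+3) ^ (W + M) * W))%N.
Proof.
rewrite !card_prod !card_ffun card_bool !card_ord card_dep_ffun.
rewrite foldrE big_map big_enum /=; congr (_ * (_ * _))%N.
by apply: eq_bigr => k _; rewrite card_ffun card_dihedral card_ord.
Qed.

Lemma window_seq : exists F : seq G,
  [/\ uniq F, (size F <= #|window_code|)%N & forall g, g \in F <-> in_window g].
Proof.
pose F0 : seq G := pmap insub [seq window_decode c | c : window_code].
exists [seq g <- undup F0 | `[< in_window g >]]; split.
- by rewrite filter_uniq// undup_uniq.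
- rewrite size_filter (leq_trans (count_size _ _))//.
  rewrite (leq_trans (size_undup _))// size_pmap.
  by rewrite (leq_trans (count_size _ _))// size_map -cardE.
- move=> g; rewrite mem_filter mem_undup; split=> [/andP[/asboolP]//|gW].
  apply/andP; split; first exact/asboolP.
  rewrite mem_pmap_sub /=; have [c <-] := in_window_decode gW.
  by apply/mapP; exists c; rewrite ?mem_enum.
Qed.

(** The letters a and b never leave the set. A unit shift leaves only from an extreme slice, and
    translation by powers of t shows that the W slices have equal size. *)
Lemma folner_window : (0 < W)%N -> win W 0%R -> folner gens W #|window_code|.
Proof.
move=> W0 win0; have [F [uF Fcode FP]] := window_seq.
exists F; split => //.
  rewrite Fcode andbT; case: F FP {uF Fcode} => // /(_ 1%g)[_]; rewrite in_nil.
  case/(_ _)/Bool.diff_false_true; split; first by [].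
    by exists xpred0, xpred0 => k i _; rewrite !andbF /lit mulg1.
  by [].
pose slice (j : nat) := count (fun g => pos g == (lo + j%:Z)%R) F.
have slice_le j j' : (j < W)%N -> (j' < W)%N -> (slice j <= slice j')%N.
  move=> jW j'W.
  apply: (leq_count_inj (f := fun g => g * gsh (j'%:Z - j%:Z)%R)%g) => //.
    by move=> g h _ _ /mulIg.
  move=> g /FP gF /eqP gj; rewrite posM gj; apply/andP; split; last first.
    by apply/eqP; rewrite /pos /=; lia.
  by apply/FP/in_window_shift => //; rewrite gj /win; lia.
have slice_sum : (\sum_(j <- iota 0 W) slice j = size F)%N.
  under eq_bigr do rewrite /slice count_sum.
  rewrite exchange_big/= -[RHS]muln1 -sum_seq_const; apply: eq_big_seq => g gF.
  have /FP[/andP[lo_g g_lo] _ _] := gF.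
  rewrite -[RHS](_ : (`|pos g - lo|%N \in iota 0 W) = 1%N :> nat).
    rewrite -sum_eq_uniq ?iota_uniq//; apply: eq_bigr => j _; congr nat_of_bool.
    by apply/eqP/eqP; lia.
  by rewrite mem_iota add0n /=; move: lo_g g_lo; lia.
have slice_W j : (j < W)%N -> (W * slice j <= size F)%N.
  move=> jW; rewrite -slice_sum -{1}(size_iota 0 W) -sum_seq_const.
  by apply: leq_sum_seq => i; rewrite mem_iota add0n => /andP[_]; apply: slice_le.
have bd0 s : (forall g, in_window g -> in_window (g * s)%g) -> bd F s = 0%N.
  move=> Fs; apply/eqP; rewrite /bd /exits -leqn0 leqNgt -has_count.
  by apply/hasPn => g /FP/Fs/FP ->.
have bd_slice n j : (j < W)%N ->
    (forall g, in_window g -> win W (pos g + n)%R || (pos g == (lo + j%:Z)%R)) ->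
    (W * bd F (gsh n) <= size F)%N.
  move=> jW nj; apply: leq_trans (slice_W j jW); rewrite leq_mul2l.
  apply/orP; right; apply: (leq_count_inj (f := id)) => // g gF gnF.
  rewrite gF; have /FP gW := gF; have /orP[gn|//] := nj g gW.
  by case/negP: gnF; apply/FP/in_window_shift.
move=> s; rewrite /gens /= !inE => /or4P[] /eqP ->.
- apply: (bd_slice _ W.-1); first by rewrite prednK.
  by move=> g [gW _ _]; move: gW; rewrite /win; lia.
- apply: (bd_slice _ 0%N); first by [].
  by move=> g [gW _ _]; move: gW; rewrite /win; lia.
- by rewrite bd0 ?muln0// => g; apply: in_window_a.
- by rewrite bd0 ?muln0// => g; apply: in_window_b.
Qed.

End Fixed.
End Window.

(** * Asymptotic dimension *)

(** Points at distance at most r lie in equal or adjacent blocks of length r + 1, and adjacent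
    blocks have opposite parities. *)
Lemma divz_same_parity (x y : int) (r : nat) :
  odd `|(x %/ r.+1)%Z| = odd `|(y %/ r.+1)%Z| -> (`|y - x| <= r)%N ->
  (x %/ r.+1)%Z = (y %/ r.+1)%Z.
Proof.
have far (a b : int) : odd `|(a %/ r.+1)%Z| = odd `|(b %/ r.+1)%Z| ->
    ((a %/ r.+1)%Z < (b %/ r.+1)%Z)%R -> (`|(b - a)%R| <= r)%N -> False.
  have := divz_eq a r.+1; have := divz_eq b r.+1.
  have a0 := modz_ge0 a (isT : r.+1%:Z%R != 0%R).
  have b0 := modz_ge0 b (isT : r.+1%:Z%R != 0%R).
  have aL := ltz_pmod a (isT : (0 < r.+1%:Z)%R).
  have bL := ltz_pmod b (isT : (0 < r.+1%:Z)%R).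
  move: (a %/ _)%Z (b %/ _)%Z (a %% _)%Z (b %% _)%Z a0 b0 aL bL.
  move=> p q u v u0 v0 ur vr bE aE pq_odd pq ab.
  have pq2 : (0 <= q - p - 2)%R by move: pq_odd pq; clear; lia.
  have : (0 <= (q - p - 2) * r.+1%:Z)%R by rewrite mulr_ge0.
  rewrite 2!mulrBl; move: ab; rewrite aE bE.
  move: (p * _)%R (q * _)%R ur vr u0 v0; clear; lia.
move=> pq_odd xy; apply/eqP; rewrite eq_le !leNgt; apply/andP.
by split; apply/negP => lt_pq;
  [apply: (far y x)|apply: (far x y)] => //; rewrite distnC.
Qed.

Section Asdim.
Variables (l m : nat -> nat) (A : pred nat).
Hypothesis m_unbounded : forall k, (k <= m k)%N.
Local Notation G := (Gamma l m A).
Local Notation gsh := (@gsh l m A).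
Local Notation gens := (@gens l m A).
Local Notation dist := (word_dist gens).
Let gensP := gens_symmetric_generating l m A.

Lemma spelled_dist (g h : G) : spelled gens (dist g h) (g^-1 * h)%g.
Proof. by have [_ SV Sgen] := gensP; apply: spelled_length. Qed.

Lemma distC (g h : G) : dist g h = dist h g.
Proof.
have [_ SV Sgen] := gensP.
by rewrite /word_dist -word_lengthV// invgM invgK.
Qed.

Lemma gens_pos s : gens s -> (`|pos s| <= 1)%N.
Proof. by rewrite /gens /= !inE => /or4P[] /eqP ->. Qed.

Lemma spelled_pos n (g : G) : spelled gens n g -> (`|pos g| <= n)%N.
Proof.
move=> [w [<- wS <-]] {n g}; elim: w wS => [|s w IH] wS.
  by rewrite big_nil.
rewrite big_cons posM /=.
have tri (a b : int) n : (`|a| <= 1 -> `|b| <= n -> `|(a + b)%R| <= n.+1)%N by lia.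
apply: tri; first exact: gens_pos (wS s (mem_head _ _)).
by apply: IH => s' ws'; apply: wS; rewrite inE ws' orbT.
Qed.

Lemma dist_pos (g h : G) : (`|pos h - pos g| <= dist g h)%N.
Proof. by have := spelled_pos (spelled_dist g h); rewrite posM posV addrC. Qed.

Section Scale.
Variable N : nat.
Let lo : int := (- N%:Z)%R.
Let W := (2 * N).+1.
Let M := \max_(k < W) m k.
Local Notation inw := (@in_window l m A lo W W M).

Lemma far_W k : (W <= k)%N -> (W <= m k)%N \/ ~~ A k.
Proof. by move=> Wk; left; apply: leq_trans Wk _. Qed.

Lemma near_W k : (k < W)%N -> (m k <= M)%N.
Proof. by move=> kW; apply: (leq_bigmax (Ordinal kW)). Qed.

Lemma in_window_word (g h : G) n : inw g -> spelled gens n h ->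
  (`|pos g| + n <= N)%N -> inw (g * h)%g.
Proof.
move=> + [w [<- wS <-]] {n h}; elim: w g wS => [|s w IH] g wS gW gN.
  by rewrite big_nil mulg1.
have ss := wS s (mem_head _ _).
have ps := gens_pos ss.
rewrite big_cons mulgA; apply: IH => [s' ws'||].
- by apply: wS; rewrite inE ws' orbT.
- move: ss ps; rewrite /gens /= !inE => /or4P[] /eqP -> ps.
  + apply: in_window_shift gW _; move: gN; rewrite /win /lo /W /=; lia.
  + apply: in_window_shift gW _; move: gN; rewrite /win /lo /W /=; lia.
  + by apply: in_window_a gW; apply: far_W.
  + by apply: in_window_b gW; [apply: far_W|apply: near_W].
- by move: gN ps; rewrite posM /=; lia.
Qed.

Lemma in_window1 : inw 1%g.
Proof.
split; first by rewrite /win /lo /W /pos /=; lia.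
  by exists xpred0, xpred0 => k i _; rewrite !andbF /lit mulg1.
by [].
Qed.

Lemma in_window_bounded : exists D, forall g : G, inw g ->
  (word_length gens g <= D)%N.
Proof.
have [F [_ _ FP]] := window_seq l m A lo W W M.
exists (\max_(g <- F) word_length gens g) => g /FP gF.
by rewrite (@leq_bigmax_seq _ F xpredT (word_length gens)).
Qed.

Lemma Gamma_amenable : exists v, folner gens W v.
Proof.
exists #|window_code l W W M|; apply: (@folner_window l m A lo W W M) => //.
- exact: far_W.
- exact: near_W.
- by rewrite /win /lo /W; lia.
Qed.

End Scale.

(** The two families are given by the parity of the block of the position; their members are the
    components of the r-step graph inside a block. A chain inside a block stays in a window around
    its start, and a window is a finite set. *)
Lemma Gamma_asdim_le1 : asdim_le dist 1.
Proof.
move=> r; pose L := r.+1.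
pose block (g : G) := (pos g %/ L%:Z)%Z.
pose R (g h : G) := block g = block h /\ (dist g h <= r)%N.
pose comp (g : G) : set G := [set h | clos_refl_sym_trans G R g h].
(* One r for the drift inside a block, another for the word spelling the next step, which may leave
   the block on its way. *)
have [D DP] := in_window_bounded (2 * r).
exists (fun k => [set comp g | g in [set g | odd `|block g| = (k != ord0)]]), D.
have block_near g h : block g = block h -> (`|pos h - pos g| <= r)%N.
  by rewrite /block /L; lia.
pose inw g := @in_window l m A (- (2 * r)%:Z)%R (2 * (2 * r)).+1
  (2 * (2 * r)).+1 (\max_(k < (2 * (2 * r)).+1) m k) g.
have step g u v : block g = block u -> R u v -> inw (g^-1 * u)%g ->
    inw (g^-1 * v)%g.
  move=> gu [uv ruv] guW; rewrite -[v](mulVKg u) mulgA.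
  apply: in_window_word guW (spelled_dist u v) _.
  by have := block_near _ _ gu; rewrite posM posV; lia.
have chain u v : clos_refl_sym_trans G R u v -> block u = block v /\
    forall g, block g = block u -> inw (g^-1 * u)%g <-> inw (g^-1 * v)%g.
  elim=> {u v} [u v|//|u v _ [-> uv]|u v w _ [-> uv] _ [vw vw']].
  - move=> Ruv; have [uv ruv] := Ruv; split=> // g gu; split; first exact: step.
    by apply: step; [rewrite gu|split; rewrite // distC].
  - by split=> // g gv; split=> /uv; apply.
  - split=> // g gu; split.
      by move=> /(proj1 (uv _ gu))/(proj1 (vw' _ gu)).
    by move=> /(proj2 (vw' _ gu))/(proj2 (uv _ gu)).
split.
- move=> g; exists (inord (odd `|block g|)), (comp g); split; last exact: rst_refl.
  by exists g => //=; rewrite -val_eqE /= inordK; case: odd.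
- move=> k _ [g _ <-] x y /= gx gy.
  have xy : clos_refl_sym_trans G R x y.
    by apply: rst_trans gy; apply: rst_sym.
  have [bxy /(_ x erefl)[+ _]] := chain _ _ xy.
  rewrite mulVg => /(_ (in_window1 _)); exact: DP.
- move=> k _ _ [g gk <-] [h hk <-] ghne x y /= gx hy.
  rewrite ltnNge; apply/negP => xyr; apply: ghne.
  have [bgx _] := chain _ _ gx; have [bhy _] := chain _ _ hy.
  have bxy : block x = block y.
    apply: divz_same_parity; last exact: leq_trans (dist_pos x y) xyr.
    by move: gk hk; rewrite /= bgx bhy => -> ->.
  have xy : clos_refl_sym_trans G R g h.
    apply: rst_trans gx _; apply: rst_trans (rst_sym _ _ _ _ hy).
    by apply: rst_step.
  apply/seteqP; split=> z /= => [gz|hz].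
    by apply: rst_trans gz; apply: rst_sym.
  exact: rst_trans hz.
Qed.

(** At scale 1 a single family puts all powers of t into one member, which is then unbounded. *)
Lemma Gamma_not_asdim_le0 : ~ asdim_le dist 0.
Proof.
move=> /(_ 1%N)[U [D [cov bound sep]]].
have [k [B [UB B0]]] := cov (gsh 0%R).
have allB (n : nat) : B (gsh n%:Z%R).
  elim: n => [//|n IH].
  have [k' [B' [UB' B'n]]] := cov (gsh n.+1%:Z%R).
  suff -> : B = B' by [].
  apply: contrapT => BB'.
  have kk' : k' = k by apply: val_inj; case: k k' {UB UB'} => [[]]// ? [[]].
  have := sep k B B' UB; rewrite -{1}kk' => /(_ UB' BB' _ _ IH B'n).
  rewrite ltnNge => /negP; apply; apply: word_length_min.
  exists [:: gsh 1%R]; split=> //.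
    by move=> s; rewrite inE => /eqP ->; apply: gens_gsh1.
  by rewrite big_seq1 gshV gshD; congr (gsh _); lia.
have := bound k B UB _ _ (allB 0%N) (allB D.+1).
have := dist_pos (gsh 0%:Z%R) (gsh D.+1%:Z%R).
by rewrite /pos /=; lia.
Qed.

Lemma Gamma_asymptotic_dimension : asymptotic_dimension G 1.
Proof.
exists gens; split; [exact: gensP|exact: Gamma_asdim_le1|].
by case=> // _; apply: Gamma_not_asdim_le0.
Qed.

End Asdim.

(** * The family *)

Lemma folner_mono (G : groupType) (S : set G) n n' v v' :
  (n <= n')%N -> (v <= v')%N -> folner S n' v -> folner S n v'.
Proof.
move=> nn' vv' [F [uF /andP[F0 Fv] FS]]; exists F; split=> //.
  by rewrite F0 (leq_trans Fv).
by move=> s /FS; apply: leq_trans; rewrite leq_mul2r nn' orbT.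
Qed.

Lemma folner_dominated_change (G H : groupType) (S S' : set G) (T T' : set H) :
  finite_symmetric_generating S -> finite_symmetric_generating S' ->
  finite_symmetric_generating T -> finite_symmetric_generating T' ->
  folner_dominated S T -> folner_dominated S' T'.
Proof.
move=> SP [S'fin _ _] [Tfin _ _] T'P [C C0 ST].
have [c c0 SS'] := folner_change S'fin SP.
have [c' c'0 TT'] := folner_change Tfin T'P.
exists (c' * (C * c))%N => [|n v T'F]; first by rewrite !muln_gt0 c'0 c0 C0.
apply: (@folner_mono _ _ n n (C * v)) => //.
  by rewrite leq_mul2r mulnCA leq_pmulr ?orbT// muln_gt0 c'0.
by apply/SS'/ST/TT'; rewrite !mulnA in T'F *.
Qed.

(* With B the product of the orders of the previous lamp groups, the Folner
   function without coordinate k is at most (8 B^2)^(k n) at the scale n = 6 r,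
   and q^r with q = grow k B is larger. *)
Definition grow (k B : nat) : nat := ((16 * B ^ 2) ^ (12 * k)).+1.

(** The product of the orders of the lamp groups before k, with [ell] unfolded to make the recursion
    structural. *)
Fixpoint vol (k : nat) : nat :=
  if k is j.+1 then vol j * (2 * (grow j (vol j)).+3) else 1.

Definition ell (k : nat) : nat := grow k (vol k).

(** The middle term is the width of the window in which coordinate j is tested, so later gaps exceed
    it; the 1 ensures gap k >= k. *)
Fixpoint gap (k : nat) : nat :=
  if k is j.+1 then gap j + 6 * (j * (ell j * (2 * gap j + 2))) + 1 else 0.

Lemma vol_prod k : vol k = (\prod_(j < k) (2 * (ell j).+3))%N.
Proof. by elim: k => [|k IH]; rewrite ?big_ord0// big_ord_recr /= -IH. Qed.

Lemma vol_gt0 k : (0 < vol k)%N.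
Proof. by rewrite vol_prod prodn_gt0. Qed.

Lemma gap_ge k : (k <= gap k)%N.
Proof. by elim: k => //= k IH; rewrite addn1 ltnS (leq_trans IH)// leq_addr. Qed.

Lemma gap_homo j k : (j <= k)%N -> (gap j <= gap k)%N.
Proof.
elim: k => [|k IH]; first by rewrite leqn0 => /eqP ->.
rewrite leq_eqVlt => /orP[/eqP -> //|]; rewrite ltnS => /IH jk.
by apply: leq_trans jk _; rewrite /= -addnA leq_addr.
Qed.

Lemma gap_succ j k : (j < k)%N ->
  (6 * (j * (ell j * (2 * gap j + 2))) <= gap k)%N.
Proof.
move=> /gap_homo; apply: leq_trans.
by rewrite /= -addnA addnCA leq_addr.
Qed.

Lemma not_folner_dominated (A A' : pred nat)
    (S : set (Gamma ell gap A)) (T : set (Gamma ell gap A')) :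
  finite_symmetric_generating S -> finite_symmetric_generating T ->
  (forall N, exists k, [/\ (N <= k)%N, A k & ~~ A' k]) ->
  ~ folner_dominated S T.
Proof.
move=> SP TP unbounded.
move=> /(folner_dominated_change SP (gens_symmetric_generating _ _ _)
          TP (gens_symmetric_generating _ _ _)) [C C0 dom].
(* A coordinate beyond C makes the window k n at least C n wide. *)
have [k [Ck Ak A'k]] := unbounded C.+1.
have k0 : (0 < k)%N by apply: leq_ltn_trans Ck.
(* With this r the requirement of [Gamma_folner_lower] reads 2 (2 r + r) <= n, whence n = 6 r. *)
pose q := ell k; pose r := (q * (2 * gap k + 2))%N; pose n := (6 * r)%N.
pose W := (6 * (k * r))%N.
have q0 : (0 < q)%N by [].
have r0 : (0 < r)%N by rewrite /r muln_gt0 q0 addn2.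
have W0 : (0 < W)%N by rewrite /W muln_gt0 /= muln_gt0 k0 r0.
have CnW : (C * n <= W)%N by rewrite /n /W mulnCA leq_mul2l leq_mul2r (ltnW Ck) orbT.
have gapW : (gap k <= W)%N.
  rewrite /W /r -{1}[gap k]mul1n; apply: leq_mul => //.
  rewrite -[gap k]mul1n; apply: leq_mul => //.
  rewrite -[gap k]mul1n; apply: leq_mul => //.
  lia.
(* Later coordinates have gap at least W, coordinate k is absent from A', and earlier ones have gap
   at most gap k. *)
have folW : folner (@gens ell gap A') W #|window_code ell W k (gap k)|.
  apply: (@folner_window ell gap A' 0%R) => //.
  - move=> j; rewrite leq_eqVlt => /orP[/eqP <-|kj]; first by right.
    by left; apply: gap_succ.
  - by move=> j jk; apply: gap_homo; apply: ltnW.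
(* The near lamps occupy W + gap k <= 2 W sites and the position costs W <= 2^W. *)
have vol_le : (#|window_code ell W k (gap k)| <= (8 * vol k ^ 2) ^ W)%N.
  rewrite card_code.
  rewrite -(big_morph (fun x => x ^ (W + gap k))%N
    (fun x y => expnMn x y (W + gap k)) (exp1n (W + gap k))) -vol_prod.
  apply: (@leq_trans (2 ^ W * 2 ^ W * (vol k ^ (2 * W) * 2 ^ W))); last first.
    rewrite expnMn -expnM (_ : 8 = 2 * 2 * 2)%N// !expnMn.
    by rewrite [(vol k ^ _ * _)%N]mulnC !mulnA.
  apply: leq_mul => //; apply: leq_mul; last exact: ltnW (ltn_expl W _).
  by rewrite leq_pexp2l ?vol_gt0// mul2n -addnn leq_add2l.
have /dom folA : folner (@gens ell gap A') (C * n) ((8 * vol k ^ 2) ^ W).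
  exact: folner_mono folW.
have n_ge : (2 * (2 * r + q * (2 * gap k + 2)) <= n)%N by rewrite /n -/r -mulSnr mulnA.
have ql : (q <= (ell k).+3)%N := leqW (leqW (leqW (leqnn (ell k)))).
have := Gamma_folner_lower Ak q0 ql n_ge folA.
apply/negP; rewrite -ltnNge.
(* C <= W <= 2^W turns C (8 vol^2)^W into at most (16 vol^2)^W. The square has exponent 2 W = 12 k
   r, and q is one more than its r-th root. *)
apply: (@leq_ltn_trans ((16 * vol k ^ 2) ^ (12 * k * r))).
  have -> : (12 * k * r = W * 2)%N by rewrite /W; move: (r) => x; clear; lia.
  rewrite expnM leq_exp2r// (_ : 16 * vol k ^ 2 = 2 * (8 * vol k ^ 2))%N; last first.
    by rewrite mulnA.
  rewrite [leqRHS]expnMn; apply: leq_mul => //.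
  apply: leq_trans (ltnW (ltn_expl W (isT : 1 < 2)%N)).
  apply: leq_trans CnW; apply: leq_pmulr.
  by rewrite /n muln_gt0.
rewrite expnM (ltn_exp2r _ _ r0); exact: ltnSn.
Qed.

(* The codes of the prefixes of x: an almost disjoint family. *)
Definition codes (x : nat -> bool) : pred nat :=
  fun k => if (unpickle k : option (seq bool)) is Some s then s == mkseq x (size s)
           else false.

Lemma codes_mkseq x y n : codes y (pickle (mkseq x n)) = (mkseq x n == mkseq y n).
Proof. by rewrite /codes pickleK size_mkseq. Qed.

(** Prefixes of x reaching past a difference with y are no prefixes of y, and injectivity of
    [pickle] makes their codes unbounded. *)
Lemma codes_diff x y : x <> y ->
  forall N, exists k, [/\ (N <= k)%N, codes x k & ~~ codes y k].
Proof.
move=> xy N.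
have [i xyi] : exists i, x i <> y i.
  by apply: contrapT => /forallNP xyE; apply: xy; apply/funext => i; apply: contrapT.
pose f n := pickle (mkseq x (i.+1 + n)).
have f_inj : injective f.
  move=> a b /(pcan_inj (@pickleK _))/(congr1 size).
  by rewrite !size_mkseq => /addnI.
have [n fn] : exists n, (N <= f n)%N.
  apply: contrapT => /forallNP small.
  suff : (size (map f (iota 0 N.+1)) <= size (iota 0 N))%N.
    by rewrite size_map !size_iota ltnn.
  apply: uniq_leq_size; first by rewrite map_inj_uniq// iota_uniq.
  move=> _ /mapP[n _ ->]; rewrite mem_iota /= add0n ltnNge.
  by apply/negP/small.
exists (f n); split=> //; rewrite codes_mkseq ?eqxx//.
apply/eqP => /(congr1 (nth false ^~ i)).
by rewrite !nth_mkseq ?ltn_addr.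
Qed.

Lemma uncountable_sequences : ~ countable [set: nat -> bool].
Proof.
move=> /pcard_injP[f f_inj].
pose D n := `[< exists x, f x = n /\ x n = false >].
have : D (f D) = ~~ D (f D).
  apply/asboolP/idP => [[x [fx xn]]|nD].
    have xD : x = D by apply: f_inj; rewrite ?inE.
    by rewrite -{1}xD -fx xD in xn *; rewrite xn.
  by exists D; split=> //; apply/negbTE.
by case: (D _).
Qed.

Unset Implicit Arguments.

Theorem theorem4 (R : realType) :
  exists (I : Type) (Gamma : I -> groupType),
    [/\ ~ countable [set: I],
        forall i, finitely_generated (Gamma i) /\ step_solvable (Gamma i) 3,
        forall i j, i <> j ->
          (~ exists f : Gamma i -> Gamma j, regular f) /\
          ~ L1_measure_equivalent R (Gamma i) (Gamma j)
      & forall i, asymptotic_dimension (Gamma i) 1].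
Proof.
exists (nat -> bool), (fun x => Gamma ell gap (codes x) : groupType); split.
- exact: uncountable_sequences.
- move=> x; split; first exact: Gamma_finitely_generated.
  (* The empty prefix belongs to every sequence, so its coordinate is always present. *)
  apply: (@Gamma_step_solvable _ _ _ (pickle ([::] : seq bool))).
  by rewrite /codes pickleK.
- move=> x y /codes_diff xy; split.
    move=> [f /regular_folner_dominated fdom].
    have [S' S'P n|S [T [SG TG]]] := fdom; last exact: not_folner_dominated.
    have [S'fin _ _] := S'P.
    have [c _ cP] := folner_change S'fin (gens_symmetric_generating ell gap (codes x)).
    have [v nv] := Gamma_amenable ell (codes x) gap_ge (c * n).
    by exists v; apply: cP; apply: folner_mono nv => //; rewrite -ltnS; lia.
  by move=> /L1_folner_dominated[S [T [SG TG]]]; exact: not_folner_dominated.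
- move=> x; apply: Gamma_asymptotic_dimension; exact: gap_ge.
Qed.
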